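(* There exist a separable Banach space $X$ and a separable subspace $Y\subset X^*$ such that $Y^*$ contains closed norming subspaces of infinite codimension, but $Y$ is not isomorphic to a total subspace of $X^*$ (that is, there is no isomorphic embedding $T:Y\to X^*$ whose image $T(Y)$ is total).
   Context: For a Banach space $X$, $X^*$ denotes its dual and $S(X)$ its unit sphere. ''Subspace'' means linear subspace (closedness is stated when required). A subspace $M\subset X^*$ is total if for every $0\neq x\in X$ there is $f\in M$ with $f(x)\neq 0$. A subspace $M\subset X^*$ is norming (over $X$) if there is $c>0$ such that $\sup_{f\in S(M)}|f(x)|\ge c\|x\|$ for all $x\in X$, where $S(M)$ is the unit sphere of $M$. In particular, a norming subspace of $Y^*$ means norming over $Y$. An isomorphic embedding is a bounded linear operator that is an isomorphism (linear homeomorphism) onto its image. *)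

(* Defs.v *)
From HB Require Import structures.
From mathcomp Require Import all_boot all_order all_algebra.
From mathcomp Require Import all_classical all_reals all_analysis.

Set Implicit Arguments.
Unset Strict Implicit.
Unset Printing Implicit Defensive.

Import Order.TTheory GRing.Theory Num.Theory.
Import numFieldNormedType.Exports.

Local Open Scope classical_set_scope.
Local Open Scope ring_scope.

Section DualSpace.
Variables (R : realType) (V : normedModType R).

Definition continuous_functional : {pred V -> R} :=
  [pred f | `[< linear f /\ continuous f >]].

Record dual_space := DualSpace {
  dual_fun :> V -> R;
  dual_funP : dual_fun \in continuous_functional
}.

HB.instance Definition _ := [isSub for dual_fun].
HB.instance Definition _ := [Choice of dual_space by <:].

Lemma continuous_functional_submod : submod_closed continuous_functional.
Proof.
split=> [|a f g /asboolP[lf cf] /asboolP[lg cg]]; apply/asboolP; split.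
- by move=> a x y; rewrite [RHS]addr0 scaler0.
- exact: cst_continuous.
- move=> b x y.
  have fE : f (b *: x + y) = b * f x + f y :> R := lf b x y.
  have gE : g (b *: x + y) = b * g x + g y :> R := lg b x y.
  change (a * f (b *: x + y) + g (b *: x + y) =
    b * (a * f x + g x) + (a * f y + g y) :> R).
  by rewrite fE gE !mulrDr !mulrA [b * a]mulrC addrACA.
- by move=> x; apply: cvgD; [apply: cvgZr; exact: cf | exact: cg].
Qed.

HB.instance Definition _ :=
  GRing.isSubmodClosed.Build R (V -> R) continuous_functional
    continuous_functional_submod.
HB.instance Definition _ := [SubChoice_isSubLmodule of dual_space by <:].

Lemma dual_fun_linear (f : dual_space) : linear f.
Proof. by case: f => f /= /asboolP[]. Qed.

HB.instance Definition _ (f : dual_space) :=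
  GRing.isLinear.Build R V R *:%R (dual_fun f) (@dual_fun_linear f).

Lemma dual_fun_continuous (f : dual_space) : continuous f.
Proof. by case: f => f /= /asboolP[]. Qed.

Definition dual_norm (f : dual_space) : R :=
  sup [set `|f x| | x in [set x : V | `|x| <= 1]].

Lemma dual_norm_has_sup (f : dual_space) :
  has_sup [set `|f x| | x in [set x : V | `|x| <= 1]].
Proof.
split; first by exists `|f 0|; exists 0 => //=; rewrite normr0 ler01.
have /linear_boundedP/pinfty_ex_gt0[M M0 fM] : bounded_near f (nbhs (0 : V)).
  exact/linear_bounded_continuous/dual_fun_continuous.
exists M => _ [x /= x1 <-].
by rewrite (le_trans (fM x))// ler_piMr// ltW.
Qed.

Lemma dual_norm_ub (f : dual_space) (x : V) :
  `|x| <= 1 -> `|f x| <= dual_norm f.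
Proof.
by move=> x1; apply: sup_upper_bound; [exact: dual_norm_has_sup|exists x].
Qed.

Lemma dual_norm_le (f : dual_space) (c : R) :
  (forall x : V, `|x| <= 1 -> `|f x| <= c) -> dual_norm f <= c.
Proof.
move=> fc; apply: ge_sup; first by case: (dual_norm_has_sup f).
by move=> _ [x /= x1 <-]; exact: fc.
Qed.

Lemma dual_norm_ge0 (f : dual_space) : 0 <= dual_norm f.
Proof. by rewrite (le_trans _ (@dual_norm_ub f 0 _))// normr0 ler01. Qed.

Lemma ler_dual_normD (f g : dual_space) :
  dual_norm (f + g) <= dual_norm f + dual_norm g.
Proof.
apply: dual_norm_le => x x1 /=; rewrite (le_trans (ler_normD _ _))//.
by rewrite lerD// dual_norm_ub.
Qed.

Lemma dual_normZ (a : R) (f : dual_space) :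
  dual_norm (a *: f) = `|a| * dual_norm f.
Proof.
have le b g : dual_norm (b *: g) <= `|b| * dual_norm g.
  apply: dual_norm_le => x x1 /=.
  by rewrite [X in `|X|]/(b *: g x) normrZ ler_wpM2l// dual_norm_ub.
apply/eqP; rewrite eq_le le /=; have [->|a0] := eqVneq a 0.
  by rewrite normr0 mul0r dual_norm_ge0.
rewrite -ler_pdivlMl ?normr_gt0// -normfV.
by rewrite (le_trans _ (le _ _))// scalerA mulVf// scale1r.
Qed.

Lemma dual_norm0_eq0 (f : dual_space) : dual_norm f = 0 -> f = 0.
Proof.
move=> f0; apply/val_inj/funext => x /=; rewrite [RHS]/(0 : R).
have [->|x0] := eqVneq x 0; first exact: linear0.
have : `|f (`|x|^-1 *: x)| <= 0 by rewrite -f0 dual_norm_ub// normfZV.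
rewrite normr_le0 linearZ /= scaler_eq0 invr_eq0 normr_eq0 (negbTE x0) /=.
by move/eqP.
Qed.

HB.instance Definition _ := Lmodule_isNormed.Build R dual_space
  ler_dual_normD dual_normZ dual_norm0_eq0.

End DualSpace.

(* A linear subspace, not necessarily closed, as a normed space for the
   inherited norm. *)
Section SubspaceType.
Variables (R : realType) (V : normedModType R) (Y : submodClosed V).

Record subspace_type := SubspaceType {
  subspace_val :> V;
  subspace_valP : subspace_val \in Y
}.

HB.instance Definition _ := [isSub for subspace_val].
HB.instance Definition _ := [Choice of subspace_type by <:].
HB.instance Definition _ := [SubChoice_isSubLmodule of subspace_type by <:].

Definition subspace_norm (y : subspace_type) : R := `|subspace_val y|.

Lemma ler_subspace_normD (x y : subspace_type) :
  subspace_norm (x + y) <= subspace_norm x + subspace_norm y.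
Proof. exact: ler_normD. Qed.

Lemma subspace_normZ (a : R) (x : subspace_type) :
  subspace_norm (a *: x) = `|a| * subspace_norm x.
Proof. exact: normrZ. Qed.

Lemma subspace_norm0_eq0 (x : subspace_type) : subspace_norm x = 0 -> x = 0.
Proof. by move/normr0_eq0 => x0; exact/val_inj. Qed.

HB.instance Definition _ := Lmodule_isNormed.Build R subspace_type
  ler_subspace_normD subspace_normZ subspace_norm0_eq0.

End SubspaceType.

Definition separable (T : topologicalType) :=
  exists2 D : set T, countable D & dense D.

Definition total_set (R : realType) (V : normedModType R)
    (M : set (dual_space V)) :=
  forall x : V, x != 0 -> exists2 f, M f & f x != 0.

(* The set under [sup] is bounded by [`|x|]; it is empty only if [M] has no
   nonzero element, and then the [sup] is 0, the supremum in [0, +oo[. *)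
Definition norming (R : realType) (V : normedModType R)
    (M : set (dual_space V)) :=
  exists2 c : R, 0 < c &
    forall x : V, c * `|x| <= sup [set `|f x| | f in M `&` [set f | `|f| = 1]].

(* [V / M] is not spanned by the classes of finitely many vectors. *)
Definition infinite_codimension (R : realType) (V : lmodType R)
    (M : submodClosed V) :=
  ~ exists (n : nat) (e : 'I_n -> V),
      forall v : V, exists a : 'I_n -> R, v - \sum_(i < n) a i *: e i \in M.

(* A linear homeomorphism onto its image: the inverse is continuous for the
   topology induced by [W] on the range. *)
Definition isomorphic_embedding (R : realType) (V W : normedModType R)
    (T : {linear V -> W}) :=
  continuous T /\
  exists2 g : W -> V, cancel T g & {within range T, continuous g}.

(* Main.v *)
(* James' construction with values in c_0.  Let E be the space of functions
   b : N -> c_0, with b(t) supported in {k | k < t}, of finite 2-variation, and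
   let X be the sum of E and c_0.  Let Y in X^* be the linear span of the jump
   coordinates of b.  Then E = Y^*, and X^* is the sum of the closure of Y, of a
   copy of l_1 spanned by the limits b |-> lim_t b(t)_k, and of l_1 = c_0^*.
   The common kernel of the limit functionals is norming over Y because one
   jump far away makes every limit vanish at bounded cost.

   Let T : Y -> X^* be an embedding.  A series in Y^* with bounded signed sums
   has small tails (lower 2-estimate in E), hence the components of T in both
   copies of l_1 are compact.  Given g in Y^*, Hahn-Banach yields Psi in X^**
   with Psi (T y) = g y; if e is the component of Psi in E, then g - (T -) e is
   small up to finitely many directions, independent of g.  By iteration the
   operator S : X -> Y^*, S x y = T y x, maps E onto a subspace of finite
   codimension.  So S kills some x whose component in c_0 is nonzero, and the
   range of T is not total. *)
From HB Require Import structures.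
Require Import Defs.
From mathcomp Require Import all_boot all_order all_algebra.
From mathcomp Require Import all_classical all_reals all_analysis.
From mathcomp Require Import ring lra.

Set Implicit Arguments.
Unset Strict Implicit.
Unset Printing Implicit Defensive.

Import Order.TTheory GRing.Theory Num.Theory.
Import numFieldNormedType.Exports.
Local Open Scope classical_set_scope.
Local Open Scope ring_scope.

(** [Y] is total over E itself, so X must be larger than E; the summand c_0 is the room that no
    embedding of [Y] can fill. It is suitable because its dual is again l_1, so that T has one kind
    of negligible component only. Negligible means small past some index N: the first N functionals
    on [Y] stay out of control, which is why the final argument uses N + 1 vectors of c_0.

    Scalar James functions have a single limit, whose kernel has codimension one. Values in c_0 give
    infinitely many limits, and since simultaneous jumps are measured by the largest of them, the
    values of a bounded functional on late jumps are absolutely summable. The support condition k <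
    t makes every initial segment of E finite-dimensional.

    Elements of X are functions on tests and the norm is a supremum norm. Projections and estimates
    are obtained by cutting, concatenating and rescaling tests.

    Both smallness statements, for functionals on far blocks and for tails of series, come from a
    strict gain for two far pieces, then iterated: 3 < 4 in one case, sqrt 2 < 149/100 in the
    other. *)

(** * Tests for the 2-variation, and the Banach space they define *)

Section Tests.
Variable R : realType.
Implicit Types (c : nat -> R) (pi kappa : nat -> nat).

Definition etest_fun pi c kappa (t k : nat) : R :=
  if (k < t)%N && (k == kappa (pi t)) then c (pi t) else 0.

(* [pi t] is the index of the time interval of [t]; on the [i]-th interval the
   test reads the single coordinate [kappa i] with weight [c i].  The supremum
   over these tests is the 2-variation. *)
Definition is_etest (phi : nat -> nat -> R) := exists pi c kappa,
  [/\ {homo pi : s t / (s <= t)%N}, (forall n, \sum_(i < n) c i ^+ 2 <= 1)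
    & phi = etest_fun pi c kappa].

(* The summand c_0 of the space sits at time 0. *)
Definition ztest_fun (j t k : nat) : R := ((t == 0) && (k == j))%N%:R.

Definition is_test (phi : nat -> nat -> R) :=
  is_etest phi \/ exists j, phi = ztest_fun j.

Record test := Test { test_fun :> nat -> nat -> R; testP : is_test test_fun }.

Lemma test_ext (phi psi : test) : phi =2 psi -> phi = psi.
Proof.
case: phi psi => [f fP] [g gP] /= fg.
have {}fg : f = g by apply/funext => t; apply/funext => k; exact: fg.
by move: fP gP; rewrite fg => fP gP; rewrite (Prop_irrelevance fP gP).
Qed.

Lemma etest_weight_le1 c i :
  (forall n, \sum_(i < n) c i ^+ 2 <= 1) -> `|c i| <= 1.
Proof.
move=> c1; rewrite -(@expr_le1 _ 2)// real_normK ?num_real//.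
apply: le_trans (c1 i.+1); rewrite big_ord_recr /= lerDr.
by apply: sumr_ge0 => j _; exact: sqr_ge0.
Qed.

Lemma test_le1 (phi : test) t k : `|phi t k| <= 1.
Proof.
case: (testP phi) => [[pi [c [kappa [_ c1 ->]]]]|[j ->]].
  by rewrite /etest_fun; case: ifP => _; rewrite ?normr0 ?ler01 ?etest_weight_le1.
by rewrite /ztest_fun; case: (_ && _); rewrite ?normr1 ?normr0 ?ler01.
Qed.

Lemma is_etest0 : is_etest (fun _ _ => 0 : R).
Proof.
exists (fun=> 0%N), (fun=> 0), id; split => //.
  by move=> n; rewrite big1 ?ler01// => i _; rewrite expr0n.
by apply/funext => t; apply/funext => k; rewrite /etest_fun if_same.
Qed.

Definition test0 := Test (or_introl is_etest0).

Definition comb n (a : nat -> nat -> R) (phi : test) : R :=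
  \sum_(t < n) \sum_(k < n) a t k * phi t k.

Lemma comb_widen n m a : (n <= m)%N ->
  comb n a = comb m (fun t k => if (t < n)%N && (k < n)%N then a t k else 0).
Proof.
move=> nm; apply/funext => phi; rewrite /comb.
rewrite (big_ord_widen m (fun t => \sum_(k < n) a t k * phi t k))// big_mkcond.
apply: eq_bigr => t _; case: ifPn => tn /=; last by rewrite big1// => k _; rewrite mul0r.
rewrite (big_ord_widen m (fun k => a t k * phi t k))// big_mkcond.
by apply: eq_bigr => k _; case: ifPn; rewrite ?mul0r.
Qed.

(* The space is the closure of the finitely supported families in the bounded
   functions on the tests. *)
Definition approximable : {pred test -> R} :=
  [pred x | `[< forall e : R, 0 < e -> exists n a,
                  forall phi, `|x phi - comb n a phi| <= e >]].

Record tspace := TSpace { tfun :> test -> R; tfunP : tfun \in approximable }.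

HB.instance Definition _ := [isSub for tfun].
HB.instance Definition _ := [Choice of tspace by <:].

Lemma approximable_submod : submod_closed approximable.
Proof.
split=> [|b x y /asboolP xP /asboolP yP]; apply/asboolP => e e0.
  exists 0%N, (fun _ _ => 0) => phi.
  by rewrite /comb big_ord0 subr0 normr0 ltW.
have b0 : 0 < 2 * (`|b| + 1) by rewrite mulr_gt0// ltr_wpDl.
have [n [a xa]] := xP (e / (2 * (`|b| + 1))) (divr_gt0 e0 b0).
have [m [a' ya]] := yP (e / 2) (divr_gt0 e0 (ltr0Sn R 1)).
rewrite (comb_widen a (leq_maxl n m)) in xa.
rewrite (comb_widen a' (leq_maxr n m)) in ya.
move: xa ya; set A := fun _ _ => _; set A' := fun _ _ => _ => xa ya.
exists (maxn n m), (fun t k => b * A t k + A' t k) => phi.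
have -> : comb (maxn n m) (fun t k => b * A t k + A' t k) phi =
    b * comb (maxn n m) A phi + comb (maxn n m) A' phi.
  rewrite /comb mulr_sumr -big_split /=; apply: eq_bigr => t _.
  rewrite mulr_sumr -big_split /=; apply: eq_bigr => k _.
  by rewrite mulrDl mulrA.
rewrite (_ : (b *: x + y) phi = b * x phi + y phi)// opprD addrACA -mulrBr.
rewrite (le_trans (ler_normD _ _))// [leRHS]splitr lerD// normrM.
rewrite (le_trans (ler_wpM2l (normr_ge0 b) (xa phi)))//.
rewrite mulrA ler_pdivrMr//; nra.
Qed.

HB.instance Definition _ :=
  GRing.isSubmodClosed.Build R (test -> R) approximable approximable_submod.
HB.instance Definition _ := [SubChoice_isSubLmodule of tspace by <:].

Definition tnorm (x : tspace) : R := sup (range (fun phi => `|x phi|)).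

Lemma tnorm_has_sup (x : tspace) : has_sup (range (fun phi => `|x phi|)).
Proof.
split; first by exists `|x test0|, test0.
have /asboolP /(_ 1 ltr01)[n [a xa]] := tfunP x.
exists (1 + \sum_(t < n) \sum_(k < n) `|a t k|) => _ [phi _ <-].
rewrite -(subrK (comb n a phi) (x phi)) (le_trans (ler_normD _ _))// lerD//.
rewrite (le_trans (ler_norm_sum _ _ _))// ler_sum// => t _.
rewrite (le_trans (ler_norm_sum _ _ _))// ler_sum// => k _.
by rewrite normrM ler_piMr// test_le1.
Qed.

Lemma ler_tnorm (x : tspace) phi : `|x phi| <= tnorm x.
Proof. by apply: sup_upper_bound; [exact: tnorm_has_sup|exists phi]. Qed.

Lemma tnorm_le (x : tspace) (b : R) : (forall phi, `|x phi| <= b) -> tnorm x <= b.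
Proof.
move=> xb; apply: ge_sup; first by case: (tnorm_has_sup x).
by move=> _ [phi _ <-].
Qed.

Lemma tfunD (x y : tspace) phi : (x + y) phi = x phi + y phi.
Proof. by []. Qed.

Lemma tfunZ (b : R) (x : tspace) phi : (b *: x) phi = b * x phi.
Proof. by []. Qed.

Lemma tfunB (x y : tspace) phi : (x - y) phi = x phi - y phi.
Proof. by []. Qed.

Lemma tfun0 phi : (0 : tspace) phi = 0.
Proof. by []. Qed.

Lemma tfun_sum I r (P : pred I) (F : I -> tspace) phi :
  (\sum_(i <- r | P i) F i) phi = \sum_(i <- r | P i) F i phi.
Proof. by elim/big_rec2: _ => // i y x _ <-. Qed.

Lemma ler_tnormD (x y : tspace) : tnorm (x + y) <= tnorm x + tnorm y.
Proof.
apply: tnorm_le => phi; rewrite tfunD (le_trans (ler_normD _ _))//.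
by rewrite lerD// ler_tnorm.
Qed.

Lemma tnormZ (a : R) (x : tspace) : tnorm (a *: x) = `|a| * tnorm x.
Proof.
have le b y : tnorm (b *: y) <= `|b| * tnorm y.
  by apply: tnorm_le => phi; rewrite tfunZ normrM ler_wpM2l// ler_tnorm.
apply/eqP; rewrite eq_le le /=; have [->|a0] := eqVneq a 0.
  by rewrite normr0 mul0r (le_trans _ (ler_tnorm _ test0)).
rewrite -ler_pdivlMl ?normr_gt0// -normfV.
by rewrite (le_trans _ (le _ _))// scalerA mulVf// scale1r.
Qed.

Lemma tnorm0_eq0 (x : tspace) : tnorm x = 0 -> x = 0.
Proof.
move=> x0; apply/val_inj/funext => phi /=; apply/eqP.
by rewrite -normr_le0 -x0 ler_tnorm.
Qed.

HB.instance Definition _ := Lmodule_isNormed.Build R tspace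
  ler_tnormD tnormZ tnorm0_eq0.

Lemma tspace_norm (x : tspace) phi : `|x phi| <= `|x|.
Proof. exact: ler_tnorm. Qed.

Lemma tspace_norm_le (x : tspace) (b : R) :
  (forall phi, `|x phi| <= b) -> `|x| <= b.
Proof. exact: tnorm_le. Qed.

(** The Cauchy estimate is uniform in the test, so the pointwise limit is a uniform one, and
    approximability survives uniform limits. *)
Lemma tspace_complete (F : set_system tspace) :
  ProperFilter F -> cauchy F -> cvg F.
Proof.
move=> PF /cauchy_ballP cF.
have evc phi : cvg ((fun x : tspace => x phi) @ F).
  apply: cauchy_cvg; apply/cauchy_ballP => e e0.
  have [[A B] [/= FA FB] AB] := cF e e0.
  exists ((fun x : tspace => x phi) @` A, (fun x : tspace => x phi) @` B).
    split => /=.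
      by apply: filterS FA => x Ax; exists x.
    by apply: filterS FB => x Bx; exists x.
  move=> [_ _] [/= [x Ax <-] [y By <-]].
  have := AB (x, y) (conj Ax By); rewrite /= -!ball_normE /ball_ /=.
  by apply: le_lt_trans; rewrite -tfunB tspace_norm.
pose l phi := lim ((fun x : tspace => x phi) @ F).
have near_l (e : R) : 0 < e ->
    \forall x \near F, forall phi, `|l phi - tfun x phi| <= e.
  move=> e0; have [[A B] [/= FA FB] AB] := cF e e0.
  apply: filterS FB => y By phi.
  have lx : (fun x : tspace => `|x phi - y phi|) @ F --> `|l phi - y phi|.
    by apply: cvg_norm; apply: cvgB; [exact: evc|exact: cvg_cst].
  apply: (cvgr_to_le lx); apply: filterS FA => x Ax.
  have := AB (x, y) (conj Ax By); rewrite /= -ball_normE /ball_ /= => xy.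
  by rewrite -tfunB (le_trans (tspace_norm _ _))// ltW.
have lP : l \in approximable.
  apply/asboolP => e e0.
  have e20 : 0 < e / 2 by rewrite divr_gt0.
  have [x xl] := @filter_ex _ F _ _ (near_l _ e20).
  have /asboolP /(_ _ e20)[n [a xa]] := tfunP x.
  exists n, a => phi.
  rewrite -(subrKA (x phi)) (le_trans (ler_normD _ _))// [leRHS]splitr.
  by rewrite lerD.
apply/cvg_ex; exists (TSpace lP); apply/cvgrPdist_le => e e0.
apply: filterS (near_l e e0) => x xl; apply: tspace_norm_le => phi.
by rewrite tfunB; exact: xl.
Qed.

HB.instance Definition _ := Uniform_isComplete.Build tspace tspace_complete.

End Tests.

(** * Unit jumps, time projections and the lower 2-estimate *)

Section Cuts.
Variable R : realType.
Implicit Types (x : tspace R) (phi psi : test R) (pi kappa : nat -> nat) (c : nat -> R).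

Lemma dvec_approximable t k : (fun phi : test R => phi t k) \in @approximable R.
Proof.
apply/asboolP => e e0; set n := (maxn t k).+1.
have tn : (t < n)%N by rewrite ltnS leq_maxl.
have kn : (k < n)%N by rewrite ltnS leq_maxr.
exists n, (fun s j => ((s == t) && (j == k))%:R) => phi.
rewrite /comb (bigD1 (Ordinal tn))//= (bigD1 (Ordinal kn))//= !eqxx mul1r.
rewrite big1 ?addr0; last first.
  by move=> j; rewrite -val_eqE /= => /negbTE ->; rewrite mul0r.
rewrite big1 ?addr0; last first.
  move=> s; rewrite -val_eqE /= => /negbTE ->.
  by rewrite big1// => j _; rewrite mul0r.
by rewrite subrr normr0 ltW.
Qed.

(** The unit jump of coordinate [k] at time [t], which is 0 if [0 < t <= k]; for [t = 0], the unit
    vector number [k] of c_0. *)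
Definition dvec t k := TSpace (dvec_approximable t k).

Definition fcomb n (a : nat -> nat -> R) : tspace R :=
  \sum_(t < n) \sum_(k < n) a t k *: dvec t k.

Lemma fcombE n a phi : fcomb n a phi = comb n a phi.
Proof.
by rewrite /fcomb tfun_sum; apply: eq_bigr => t _; rewrite tfun_sum.
Qed.

Lemma fcomb_dense x e : 0 < e -> exists n a, `|x - fcomb n a| <= e.
Proof.
move=> e0; have /asboolP /(_ _ e0)[n [a xa]] := tfunP x.
exists n, a; apply: tspace_norm_le => phi.
by rewrite tfunB fcombE.
Qed.

(** Finite combinations of the [dvec] are linear in the test, and every [x] is a uniform limit of
    them. Tests do not form a vector space, hence the relation between them is stated pointwise. *)
Lemma tfun_lin x phi I (r : seq I) (c : I -> R) (psi : I -> test R) :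
  (forall t k, phi t k = \sum_(i <- r) c i * psi i t k) ->
  x phi = \sum_(i <- r) c i * x (psi i).
Proof.
move=> phiE; apply/eqP; rewrite -subr_eq0 -normr_le0; apply/ler_addgt0Pl => e e0.
rewrite addr0; set s := 1 + \sum_(i <- r) `|c i|.
have s0 : 0 < s by rewrite ltr_wpDr// sumr_ge0.
have [n [a xa]] := fcomb_dense x (divr_gt0 e0 s0).
have FE : fcomb n a phi = \sum_(i <- r) c i * fcomb n a (psi i).
  rewrite fcombE /comb.
  transitivity (\sum_(t < n) \sum_(k < n) \sum_(i <- r) c i * (a t k * psi i t k)).
    apply: eq_bigr => t _; apply: eq_bigr => k _.
    by rewrite phiE mulr_sumr; apply: eq_bigr => i _; rewrite mulrCA.
  under eq_bigr do rewrite exchange_big /=.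
  rewrite exchange_big /=; apply: eq_bigr => i _.
  rewrite fcombE /comb mulr_sumr; apply: eq_bigr => t _.
  by rewrite mulr_sumr.
have -> : x phi - \sum_(i <- r) c i * x (psi i) =
    (x - fcomb n a) phi - \sum_(i <- r) c i * (x - fcomb n a) (psi i).
  under [in RHS]eq_bigr do rewrite tfunB mulrBr.
  by rewrite sumrB tfunB -FE; ring.
rewrite (le_trans (ler_normB _ _))//.
have -> : e = e / s + \sum_(i <- r) `|c i| * (e / s).
  rewrite -mulr_suml -[X in X + _]mul1r -mulrDl -/s mulrC divfK//.
  by rewrite gt_eqF.
rewrite lerD//; first by rewrite (le_trans (tspace_norm _ _)).
rewrite (le_trans (ler_norm_sum _ _ _))// ler_sum// => i _.
by rewrite normrM ler_wpM2l// (le_trans (tspace_norm _ _)).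
Qed.

Lemma tfun_lin1 x phi a psi :
  (forall t k, phi t k = a * psi t k) -> x phi = a * x psi.
Proof.
move=> E; rewrite (@tfun_lin x phi unit [:: tt] (fun=> a) (fun=> psi)) ?big_seq1//.
by move=> t k; rewrite big_seq1.
Qed.

Lemma tfun_lin2 x phi a1 psi1 a2 psi2 :
  (forall t k, phi t k = a1 * psi1 t k + a2 * psi2 t k) ->
  x phi = a1 * x psi1 + a2 * x psi2.
Proof.
move=> E; rewrite (@tfun_lin x phi bool [:: true; false]
  (fun b => if b then a1 else a2) (fun b => if b then psi1 else psi2)).
  by rewrite !big_cons big_nil addr0.
by move=> t k; rewrite !big_cons big_nil addr0.
Qed.

Lemma tfun_zero x phi : (forall t k, phi t k = 0) -> x phi = 0.
Proof.
by move=> E; rewrite (@tfun_lin1 x phi 0 phi) ?mul0r// => t k; rewrite mul0r.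
Qed.

Lemma dvecE t k phi : dvec t k phi = phi t k. Proof. by []. Qed.

Lemma test_adm phi t k : (0 < t)%N -> (t <= k)%N -> phi t k = 0.
Proof.
move=> t0 tk; case: (testP phi) => [[pi [c [kappa [_ _ ->]]]]|[j ->]].
  by rewrite /etest_fun ltnNge tk.
by rewrite /ztest_fun gtn_eqF.
Qed.

(* An initial segment of the time axis, possibly all of it. *)
Record cut := Cut {
  cut_fun :> nat -> bool;
  cutP : forall s t, (s <= t)%N -> cut_fun t -> cut_fun s }.

Lemma before_subproof n s t : (s <= t)%N -> (t < n)%N -> (s < n)%N.
Proof. exact: leq_ltn_trans. Qed.

Definition before n := Cut (@before_subproof n).

(** The intervals of the second test are renumbered from [b] on, past all those that the first one
    uses inside the cut. The squared weights then add up to at most [al ^+ 2 + be ^+ 2]. *)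
Lemma concat_etest (m : cut) pi1 c1 kappa1 pi2 c2 kappa2 (al be : R) :
  {homo pi1 : s t / (s <= t)%N} -> (forall n, \sum_(i < n) c1 i ^+ 2 <= 1) ->
  {homo pi2 : s t / (s <= t)%N} -> (forall n, \sum_(i < n) c2 i ^+ 2 <= 1) ->
  al ^+ 2 + be ^+ 2 <= 1 ->
  is_etest (fun t k => if m t then al * etest_fun pi1 c1 kappa1 t k
                       else be * etest_fun pi2 c2 kappa2 t k).
Proof.
move=> pi1P c1P pi2P c2P ab1.
(* If the cut is the whole axis, [pi1] may be unbounded on it and no shift [b] exists; but then the
   second test is absent. *)
have [[t0 mt0]|mall] := pselect (exists t, ~~ m t); last first.
  exists pi1, (fun i => al * c1 i), kappa1; split => //.
    move=> n; under eq_bigr do rewrite exprMn.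
    rewrite -mulr_sumr (le_trans _ ab1)// (le_trans _ (_ : al ^+ 2 * 1 <= _))//.
      by rewrite ler_wpM2l// sqr_ge0.
    by rewrite mulr1 lerDl sqr_ge0.
  apply/funext => t; apply/funext => k; rewrite /etest_fun.
  have -> : m t by apply: contrapT => mt; apply: mall; exists t; apply/negP.
  by case: ifP; rewrite ?mulr0.
have mlt t : m t -> (t <= t0)%N.
  by move=> mt; rewrite leqNgt; apply: contra mt0 => /ltnW/cutP; exact.
set b := (pi1 t0).+1.
exists (fun t => if m t then pi1 t else b + pi2 t)%N,
  (fun i => if (i < b)%N then al * c1 i else be * c2 (i - b)%N),
  (fun i => if (i < b)%N then kappa1 i else kappa2 (i - b)%N); split.
- move=> s t st; case: ifPn => ms; case: ifPn => mt.
  + exact: pi1P.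
  + by rewrite (leq_trans (pi1P _ _ (mlt _ ms)))// ltnW// ltn_addr.
  + by case/negP: ms; exact: cutP mt.
  + by rewrite leq_add2l pi2P.
- move=> n; rewrite (le_trans _ ab1)//.
  have sum_le n' : \sum_(i < b + n') (if (i < b)%N then al * c1 i
      else be * c2 (i - b)%N) ^+ 2 <= al ^+ 2 + be ^+ 2.
    rewrite big_split_ord /=; apply: lerD.
      rewrite (eq_bigr (fun i : 'I_b => al ^+ 2 * c1 i ^+ 2)); last first.
        by move=> i _; rewrite ltn_ord exprMn.
      by rewrite -mulr_sumr ler_piMr ?sqr_ge0 ?c1P.
    rewrite (eq_bigr (fun i : 'I_n' => be ^+ 2 * c2 i ^+ 2)); last first.
      by move=> i _; rewrite ltnNge leq_addr /= addKn exprMn.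
    by rewrite -mulr_sumr ler_piMr ?sqr_ge0 ?c2P.
  apply: le_trans (sum_le n).
  rewrite [(b + n)%N]addnC big_split_ord /= lerDl.
  by apply: sumr_ge0 => i _; exact: sqr_ge0.
- apply/funext => t; apply/funext => k; rewrite /etest_fun.
  case: ifPn => mt.
    have -> : (pi1 t < b)%N by rewrite ltnS pi1P// mlt.
    by case: ifP; rewrite ?mulr0.
  have -> : (b + pi2 t < b)%N = false by rewrite ltnNge leq_addr.
  by rewrite addKn; case: ifP; rewrite ?mulr0.
Qed.

Definition mask_fun (b : nat -> bool) (phi : nat -> nat -> R) t k : R :=
  if (0 < t)%N && b t then phi t k else 0.

(* Masks erase time 0, so that the projections below take values in E. *)
Record tmask := TMask {
  mask_bool :> nat -> bool;
  maskP : forall phi : test R, is_test (mask_fun mask_bool phi) }.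

Lemma mask_etest_or0 phi : is_etest phi \/ forall b, mask_fun b phi = fun _ _ => 0.
Proof.
case: (testP phi) => [|[j ->]]; first by left.
right => b; apply/funext => t; apply/funext => k; rewrite /mask_fun.
by case: ifP => // /andP[/gtn_eqF t0 _]; rewrite /ztest_fun t0.
Qed.

Lemma mask_concat (m : cut) phi psi (al be : R) : al ^+ 2 + be ^+ 2 <= 1 ->
  is_test (fun t k => al * mask_fun m phi t k
                      + be * mask_fun (fun t => ~~ m t) psi t k).
Proof.
move=> ab1.
have mE (xi : test R) b : exists pi c kappa, [/\ {homo pi : s t / (s <= t)%N},
    (forall n, \sum_(i < n) c i ^+ 2 <= 1) &
    mask_fun b xi = fun t k => if b t then etest_fun pi c kappa t k else 0 :> R].
  case: (mask_etest_or0 xi) => [[pi [c [kappa [piP cP ->]]]]|E].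
    exists pi, c, kappa; split => //; apply/funext => t; apply/funext => k.
    by rewrite /mask_fun /etest_fun; case: t => //=; rewrite if_same.
  have [pi [c [kappa [piP cP E0]]]] := is_etest0 R.
  exists pi, c, kappa; split => //; rewrite E.
  by apply/funext => t; apply/funext => k; rewrite -E0 if_same.
left.
have [pi1 [c1 [kappa1 [? ? ->]]]] := mE phi m.
have [pi2 [c2 [kappa2 [? ? ->]]]] := mE psi (fun t => ~~ m t).
rewrite (_ : (fun _ _ => _) = fun t k => if m t then al * etest_fun pi1 c1 kappa1 t k
                       else be * etest_fun pi2 c2 kappa2 t k); last first.
  by apply/funext => t; apply/funext => k; case: ifP; rewrite ?mulr0 ?addr0 ?add0r.
exact: concat_etest.
Qed.

Lemma lo_subproof (m : cut) phi : is_test (mask_fun m phi).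
Proof.
have : (1 : R) ^+ 2 + 0 ^+ 2 <= 1 by rewrite expr1n expr0n addr0.
move=> /(mask_concat m phi phi); congr is_test.
by apply/funext => t; apply/funext => k; rewrite mul1r mul0r addr0.
Qed.

Lemma hi_subproof (m : cut) phi : is_test (mask_fun (fun t => ~~ m t) phi).
Proof.
have : (0 : R) ^+ 2 + 1 ^+ 2 <= 1 by rewrite expr1n expr0n add0r.
move=> /(mask_concat m phi phi); congr is_test.
by apply/funext => t; apply/funext => k; rewrite mul1r mul0r add0r.
Qed.

Definition lo m := TMask (lo_subproof m).
Definition hi m := TMask (hi_subproof m).

Definition mtest (b : tmask) phi := Test (maskP b phi).

Lemma mtestE b phi t k : mtest b phi t k = if (0 < t)%N && b t then phi t k else 0.
Proof. by []. Qed.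

Lemma proj_approximable (b : tmask) x : (fun phi => x (mtest b phi)) \in @approximable R.
Proof.
apply/asboolP => e e0; have /asboolP /(_ _ e0)[n [a xa]] := tfunP x.
exists n, (fun t k => if (0 < t)%N && b t then a t k else 0) => phi.
have <- : comb n a (mtest b phi) =
    comb n (fun t k => if (0 < t)%N && b t then a t k else 0) phi.
  apply: eq_bigr => t _; apply: eq_bigr => k _; rewrite mtestE.
  by case: ifP => _; rewrite ?mulr0 ?mul0r.
exact: xa.
Qed.

Definition proj b x := TSpace (proj_approximable b x).

Lemma projE b x phi : proj b x phi = x (mtest b phi). Proof. by []. Qed.

Lemma proj_linear b : linear (proj b).
Proof. by move=> a x y; apply/val_inj/funext. Qed.

HB.instance Definition _ b :=
  GRing.isLinear.Build R (tspace R) (tspace R) *:%R (proj b) (@proj_linear b).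

Lemma proj_norm b x : `|proj b x| <= `|x|.
Proof. by apply: tspace_norm_le => phi; rewrite projE tspace_norm. Qed.

Lemma proj_dvec b t k : proj b (dvec t k) = if (0 < t)%N && b t then dvec t k else 0.
Proof.
by apply/val_inj/funext => phi /=; rewrite /mask_fun; case: ifP.
Qed.

Lemma proj_comp (b b1 b2 : tmask) x :
  (forall t, (0 < t)%N -> b t = b1 t && b2 t) -> proj b1 (proj b2 x) = proj b x.
Proof.
move=> bE; apply/val_inj/funext => phi; rewrite /=; congr (x _).
apply: test_ext => t k; rewrite !mtestE.
case: (ltnP 0%N t) => //= t0; rewrite bE//.
by case: (b1 t); case: (b2 t).
Qed.

(** Tests on the two sides of the cut, weighted by any [(al, be)] in the unit disc, concatenate to
    one test; signs are absorbed in the weights. The optimal weights are proportional to the two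
    norms. *)
Lemma lo_hi_sqr (m : cut) x :
  `|proj (lo m) x| ^+ 2 + `|proj (hi m) x| ^+ 2 <= `|x| ^+ 2.
Proof.
have lin (al be : R) : al ^+ 2 + be ^+ 2 <= 1 ->
    `|al *: proj (lo m) x| + `|be *: proj (hi m) x| <= `|x|.
  move=> ab1; rewrite -lerBrDr; apply: tspace_norm_le => phi.
  rewrite lerBrDr addrC -lerBrDr; apply: tspace_norm_le => psi.
  rewrite lerBrDr !tfunZ !projE.
  pose sg (u : R) : R := if 0 <= u then 1 else -1.
  have sgE u : sg u * u = `|u|.
    by rewrite /sg; case: ifPn => u0; [rewrite mul1r ger0_norm|
      rewrite mulN1r ltr0_norm// ltNge].
  have sg2 u : sg u ^+ 2 = 1 by rewrite /sg; case: ifP; rewrite ?sqrrN expr1n.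
  set u := al * _; set v := be * _.
  have ab2 : (sg u * al) ^+ 2 + (sg v * be) ^+ 2 <= 1.
    by rewrite !exprMn !sg2 !mul1r.
  have := tspace_norm x (Test (mask_concat m phi psi ab2)).
  rewrite (@tfun_lin2 x _ (sg u * al) (mtest (lo m) phi)
    (sg v * be) (mtest (hi m) psi)) //.
  rewrite -!mulrA -/u -/v !sgE ger0_norm ?addr_ge0//.
  by rewrite addrC.
set A := `|proj (lo m) x|; set B := `|proj (hi m) x|.
have [AB0|AB0] := leP (A ^+ 2 + B ^+ 2) 0.
  by rewrite (le_trans AB0)// sqr_ge0.
set s := Num.sqrt (A ^+ 2 + B ^+ 2).
have s0 : 0 < s by rewrite sqrtr_gt0.
have s2 : s ^+ 2 = A ^+ 2 + B ^+ 2 by rewrite sqr_sqrtr// ltW.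
rewrite -s2 ler_sqr ?nnegrE ?(ltW s0)//.
have := lin (A / s) (B / s).
rewrite !normrZ -/A -/B !ger0_norm ?divr_ge0 ?invr_ge0 ?normr_ge0 ?(ltW s0)//.
rewrite !exprMn exprVn -mulrDl -s2 mulfV ?gt_eqF ?exprn_gt0//.
move=> /(_ (lexx _)) ABx; apply: le_trans ABx.
by rewrite mulrAC [X in _ + X]mulrAC -mulrDl -!expr2 -s2 expr2 mulfK// gt_eqF.
Qed.

Lemma etest_weight pi c kappa phi (w : R) x : 0 <= w ->
  {homo pi : s t / (s <= t)%N} -> (forall n, \sum_(i < n) c i ^+ 2 <= w ^+ 2) ->
  phi =2 etest_fun pi c kappa -> `|x phi| <= w * `|x|.
Proof.
rewrite le_eqVlt => /predU1P[<-|w0] piP cP phiE.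
  rewrite tfun_zero ?normr0 ?mul0r// => t k; rewrite phiE /etest_fun.
  case: ifP => // _; apply/eqP; rewrite -sqrf_eq0 eq_le sqr_ge0 andbT.
  have := cP (pi t).+1; rewrite big_ord_recr /= expr0n; apply: le_trans.
  by rewrite lerDr sumr_ge0// => i _; exact: sqr_ge0.
have psiP : is_test (etest_fun pi (fun i => c i / w) kappa).
  left; exists pi, (fun i => c i / w), kappa; split => // n.
  under eq_bigr do rewrite exprMn exprVn.
  by rewrite -mulr_suml ler_pdivrMr ?exprn_gt0// mul1r.
rewrite (@tfun_lin1 x phi w (Test psiP)).
  by rewrite normrM gtr0_norm// ler_pM2l// tspace_norm.
move=> t k; rewrite phiE /= /etest_fun; case: ifP; rewrite ?mulr0// => _.
by rewrite mulrC divfK// gt_eqF.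
Qed.

Lemma ltest_subproof j : is_test (fun t k => ((k < t)%N && (k == j))%:R : R).
Proof.
left; exists (fun=> 0%N), (fun i => (i == 0)%N%:R), (fun=> j); split => //.
  by case=> [|n]; rewrite ?big_ord0// big_ord_recl /= expr1n big1 ?addr0// => i _;
    rewrite expr0n.
by apply/funext => t; apply/funext => k; rewrite /etest_fun; case: ifP.
Qed.

(** The limit functional b |-> lim_t b(t)_j: a single interval covers all times and adds up all the
    jumps of coordinate [j]. *)
Definition ltest j := Test (ltest_subproof j).

Definition ztest j := Test (or_intror (ex_intro _ j erefl) : is_test (ztest_fun R j)).

End Cuts.

(** * Two successive blocks with zero sum *)

Section Blocks.
Variable R : realType.
Implicit Types (x h : tspace R) (phi psi : test R) (pi kappa : nat -> nat) (c : nat -> R).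

Lemma tfun_lin2_on (b : tmask R) h phi a1 psi1 a2 psi2 : proj b h = h ->
  (forall t k, (0 < t)%N -> b t -> phi t k = a1 * psi1 t k + a2 * psi2 t k) ->
  h phi = a1 * h psi1 + a2 * h psi2.
Proof.
move=> bh E; rewrite -bh !projE; apply: tfun_lin2 => t k; rewrite !mtestE.
by case: ifP => [/andP[]|]; [exact: E|rewrite !mulr0 addr0].
Qed.

Lemma tfun_on (b : tmask R) h phi : (forall t k, (0 < t)%N -> b t = false -> phi t k = 0) ->
  (forall k, phi 0%N k = 0) -> h phi = proj b h phi.
Proof.
move=> E E0; rewrite projE; congr (h _); apply: test_ext => t k; rewrite mtestE.
by case: t => [|t] //=; case: ifPn => // /negbTE; exact: E.
Qed.

Lemma sum_sqr_split c n i : (forall n, \sum_(j < n) c j ^+ 2 <= 1) ->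
  \sum_(j < n) (if (j < i)%N then c j else 0) ^+ 2 <= \sum_(j < i) c j ^+ 2 /\
  \sum_(j < n) (if (i < j)%N then c j else 0) ^+ 2 <=
    1 - \sum_(j < i) c j ^+ 2 - c i ^+ 2.
Proof.
move=> c1.
have widen (d : nat -> R) m : \sum_(j < n) d j ^+ 2 <= \sum_(j < n + m) d j ^+ 2.
  by rewrite big_split_ord /= lerDl; apply: sumr_ge0 => j _; exact: sqr_ge0.
split.
  apply: le_trans (widen (fun j => if (j < i)%N then c j else 0) i) _.
  rewrite addnC big_split_ord /=.
  rewrite [X in _ + X]big1 ?addr0.
    by under eq_bigr do rewrite ltn_ord.
  by move=> j _; rewrite ltnNge leq_addr /= expr0n.
have := c1 (i.+1 + n)%N; rewrite big_split_ord big_ord_recr /= => ci.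
apply: le_trans (widen (fun j => if (i < j)%N then c j else 0) i.+1) _.
rewrite addnC big_split_ord big_ord_recr /=.
rewrite big1 ?ltnn ?expr0n ?addr0 ?add0r; last first.
  by move=> j _; rewrite ltnNge ltnW//= expr0n.
rewrite -[leLHS]addr0 lerBrDr lerBrDr addr0.
rewrite (eq_bigr (fun j : 'I_n => c (i.+1 + j)%N ^+ 2)); first lra.
by move=> j _; rewrite addSn ltnS leq_addr.
Qed.

(** Cauchy-Schwarz through the Lagrange identity. As [v1] lies below both [A] and [B], its square is
    at most 1/2, and so is that of [v2]; hence [(A ^+ 2 + v1 ^+ 2) + (C ^+ 2 + v2 ^+ 2) + v1 ^+ 2 +
    v2 ^+ 2] is at most 1 + 1 + 1/2 + 1/2. *)
Lemma cauchy3_le (l r g A B C D v1 v2 : R) :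
  l ^+ 2 + r ^+ 2 + g ^+ 2 <= 1 -> 0 <= v1 -> 0 <= v2 ->
  v1 <= A -> v1 <= B -> v2 <= C -> v2 <= D ->
  A ^+ 2 + B ^+ 2 <= 1 -> C ^+ 2 + D ^+ 2 <= 1 ->
  (l * A + g * (v1 + v2) + r * C) ^+ 2 <= 3.
Proof.
move=> lrg v10 v20 vA vB vC vD AB CD.
have sq (u v : R) : 0 <= u -> u <= v -> u ^+ 2 <= v ^+ 2 by move=> ? ?; nra.
have := sq _ _ v10 vA; have := sq _ _ v10 vB.
have := sq _ _ v20 vC; have := sq _ _ v20 vD => {sq} h1 h2 h3 h4.
set w := v1 + v2.
have w2 : w ^+ 2 <= 2 * v1 ^+ 2 + 2 * v2 ^+ 2 by have := sqr_ge0 (v1 - v2); rewrite /w; nra.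
have S3 : A ^+ 2 + w ^+ 2 + C ^+ 2 <= 3 by lra.
have -> : (l * A + g * w + r * C) ^+ 2 =
  (l ^+ 2 + r ^+ 2 + g ^+ 2) * (A ^+ 2 + w ^+ 2 + C ^+ 2)
  - (l * w - g * A) ^+ 2 - (l * C - r * A) ^+ 2 - (g * C - r * w) ^+ 2 by ring.
have := sqr_ge0 (l * w - g * A); have := sqr_ge0 (l * C - r * A).
have := sqr_ge0 (g * C - r * w) => q1 q2 q3.
have S0 : 0 <= A ^+ 2 + w ^+ 2 + C ^+ 2 by rewrite !addr_ge0 ?sqr_ge0.
have := ler_wpM2r S0 lrg; rewrite mul1r; lra.
Qed.

(* Only the interval of the test containing [p] meets both blocks; since the
   blocks have zero sum, its value on [h1] is controlled by either half of [h1].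
   What matters below is that the bound is less than 4. *)
Lemma two_blocks p h1 h2 :
  proj (lo R (before p)) h1 = h1 -> proj (hi R (before p)) h2 = h2 ->
  (forall j, h1 (ltest R j) = 0) -> (forall j, h2 (ltest R j) = 0) ->
  `|h1| <= 1 -> `|h2| <= 1 -> `|h1 + h2| ^+ 2 <= 3.
Proof.
move=> lo1 hi2 z1 z2 h11 h21.
suff: `|h1 + h2| <= Num.sqrt 3.
  by move=> le3; rewrite -[3](@sqr_sqrtr _ 3)// ler_sqr ?nnegrE ?sqrtr_ge0.
apply: tspace_norm_le => phi; rewrite tfunD.
case: (testP phi) => [[pi [c [kappa [piP c1 phiE]]]]|[j phiE]]; last first.
  suff zh (b : tmask R) h : proj b h = h -> h phi = 0.
    by rewrite (zh _ _ lo1) (zh _ _ hi2) addr0 normr0 sqrtr_ge0.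
  move=> <-; rewrite projE; apply: tfun_zero => t k; rewrite mtestE phiE /ztest_fun.
  by case: t => //= t; rewrite if_same.
set i := pi p; set k0 := kappa i; set g := c i.
(* The squared weights before, at and after the interval [i] of [p] share the total 1, as [l2],
   [g ^+ 2] and [r2]. *)
have [lP rP] :
  (forall n, \sum_(j < n) (if (j < i)%N then c j else 0) ^+ 2 <=
    \sum_(j < i) c j ^+ 2) /\
  (forall n, \sum_(j < n) (if (i < j)%N then c j else 0) ^+ 2 <=
    1 - \sum_(j < i) c j ^+ 2 - g ^+ 2).
  by split=> n; case: (sum_sqr_split n i c1).
move: lP rP; set l2 := \sum_(j < i) _; set r2 := 1 - _ - _ => lP rP.
have l20 : 0 <= l2 by apply: sumr_ge0 => j _; exact: sqr_ge0.
have r20 : 0 <= r2 by apply: le_trans (rP 0%N); rewrite big_ord0.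
have g20 := sqr_ge0 g.
have TlP : is_test (etest_fun pi (fun j => if (j < i)%N then c j else 0) kappa).
  left; do 3 eexists; split; [exact: piP| |reflexivity] => n.
  rewrite (le_trans (lP n))//; move: r20; rewrite /r2; lra.
have TrP : is_test (etest_fun pi (fun j => if (i < j)%N then c j else 0) kappa).
  left; do 3 eexists; split; [exact: piP| |reflexivity] => n.
  rewrite (le_trans (rP n))// /r2; lra.
have chiP : is_test (etest_fun pi (fun j => (j == i)%:R : R) kappa).
  left; do 3 eexists; split; [exact: piP| |reflexivity] => n.
  have d1 m : \sum_(j < m) ((i + j == i)%N%:R : R) ^+ 2 <= 1.
    case: m => [|m]; first by rewrite big_ord0.
    rewrite big_ord_recl addn0 eqxx expr1n big1 ?addr0// => j _.
    by rewrite -[X in _ == X]addn0 eqn_add2l /= expr0n.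
  apply: le_trans (d1 n); apply: (@le_trans _ _ (\sum_(j < i + n) ((j == i :> nat)%:R : R) ^+ 2)).
    rewrite addnC big_split_ord /= lerDl.
    by apply: sumr_ge0 => j _; exact: sqr_ge0.
  rewrite big_split_ord /= big1 ?add0r// => j _.
  by rewrite ltn_eqF// expr0n.
set Tl := Test TlP; set Tr := Test TrP; set chi := Test chiP.
have cutLP s t : (s <= t)%N -> (pi t < i)%N -> (pi s < i)%N.
  by move=> /piP; exact: leq_ltn_trans.
have cutRP s t : (s <= t)%N -> (pi t <= i)%N -> (pi s <= i)%N.
  by move=> /piP; exact: leq_trans.
pose L := Cut cutLP; pose Rt := Cut cutRP.
have phi1 : h1 phi = h1 Tl + g * h1 chi.
  rewrite -[h1 Tl]mul1r; apply: (tfun_lin2_on lo1) => t k t0 /= tp.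
  have : (pi t <= i)%N by apply/piP/ltnW.
  rewrite phiE /= /etest_fun; case: ifP => _; last by rewrite !mulr0 addr0.
  rewrite leq_eqVlt => /predU1P[->|ti].
    by rewrite ltnn eqxx mulr0 add0r mulr1.
  by rewrite ti [pi t == i]ltn_eqF// mulr0 addr0 mul1r.
have phi2 : h2 phi = h2 Tr + g * h2 chi.
  rewrite -[h2 Tr]mul1r; apply: (tfun_lin2_on hi2) => t k t0 /= tp.
  have : (i <= pi t)%N by apply/piP; rewrite leqNgt.
  rewrite phiE /= /etest_fun; case: ifP => _; last by rewrite !mulr0 addr0.
  rewrite leq_eqVlt => /predU1P[<-|ti].
    by rewrite ltnn eqxx mulr0 add0r mulr1.
  by rewrite ti [pi t == i]gtn_eqF// mulr0 addr0 mul1r.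
have l1 : `|h1 Tl| <= Num.sqrt l2 * `|proj (lo R L) h1|.
  rewrite (tfun_on (b := lo R L)) //; last first.
    by move=> t k _ /= ti; rewrite /etest_fun ti if_same.
  apply: (@etest_weight R pi (fun j => if (j < i)%N then c j else 0) kappa) => // n.
  by rewrite sqr_sqrtr.
have r1 : `|h2 Tr| <= Num.sqrt r2 * `|proj (hi R Rt) h2|.
  rewrite (tfun_on (b := hi R Rt)) //; last first.
    by move=> t k _ /= /negbFE ti; rewrite /etest_fun [(i < _)%N]ltnNge ti if_same.
  apply: (@etest_weight R pi (fun j => if (i < j)%N then c j else 0) kappa) => // n.
  by rewrite sqr_sqrtr.
have u1B : `|h1 chi| <= `|proj (hi R L) h1|.
  rewrite (tfun_on (b := hi R L)) ?tspace_norm//.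
  by move=> t k _ /= /negbFE ti; rewrite /etest_fun [pi t == i]ltn_eqF//; case: ifP.
have u2D : `|h2 chi| <= `|proj (lo R Rt) h2|.
  rewrite (tfun_on (b := lo R Rt)) ?tspace_norm//.
  by move=> t k _ /= ti; rewrite /etest_fun [pi t == i]gtn_eqF; [case: ifP|rewrite ltnNge ti].
(* [h1] lives before [p], hence in the intervals up to [i], and its coordinate [k0] sums to 0: the
   interval [i] carries the opposite of what the earlier ones carry. *)
have u1A : `|h1 chi| <= `|proj (lo R L) h1|.
  suff -> : h1 chi = - proj (lo R L) h1 (ltest R k0) by rewrite normrN tspace_norm.
  apply/eqP; rewrite -addr_eq0 projE -(z1 k0) eq_sym; apply/eqP.
  rewrite -[h1 chi]mul1r -[X in _ + X]mul1r; apply: (tfun_lin2_on lo1) => t k t0 /= tp.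
  have : (pi t <= i)%N by apply/piP/ltnW.
  rewrite /mask_fun t0 /= /etest_fun leq_eqVlt !mul1r => /predU1P[->|ti].
    by rewrite ltnn eqxx addr0 -/k0; case: (_ && _).
  rewrite ti [pi t == i]ltn_eqF//.
  by case: ifP; rewrite add0r.
have u2C : `|h2 chi| <= `|proj (hi R Rt) h2|.
  suff -> : h2 chi = - proj (hi R Rt) h2 (ltest R k0) by rewrite normrN tspace_norm.
  apply/eqP; rewrite -addr_eq0 projE -(z2 k0) eq_sym; apply/eqP.
  rewrite -[h2 chi]mul1r -[X in _ + X]mul1r; apply: (tfun_lin2_on hi2) => t k t0 /= tp.
  have : (i <= pi t)%N by apply/piP; rewrite leqNgt.
  rewrite /mask_fun t0 /= /etest_fun leq_eqVlt !mul1r => /predU1P[<-|ti].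
    by rewrite leqnn eqxx addr0 -/k0; case: (_ && _).
  by rewrite -ltnNge ti [pi t == i]gtn_eqF//; case: ifP; rewrite add0r.
have n1 : `|proj (lo R L) h1| ^+ 2 + `|proj (hi R L) h1| ^+ 2 <= 1.
  by apply: le_trans (lo_hi_sqr _ _) _; rewrite expr_le1.
have n2 : `|proj (hi R Rt) h2| ^+ 2 + `|proj (lo R Rt) h2| ^+ 2 <= 1.
  by rewrite addrC; apply: le_trans (lo_hi_sqr _ _) _; rewrite expr_le1.
have lrg : Num.sqrt l2 ^+ 2 + Num.sqrt r2 ^+ 2 + `|g| ^+ 2 <= 1.
  by rewrite !sqr_sqrtr// real_normK ?num_real// /r2; lra.
have := cauchy3_le lrg (normr_ge0 _) (normr_ge0 _) u1A u1B u2C u2D n1 n2.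
set V := _ + _ => V3.
have V0 : 0 <= V by rewrite !addr_ge0 ?mulr_ge0 ?addr_ge0 ?sqrtr_ge0.
rewrite (@le_trans _ _ V)//; last by rewrite -(ler_sqr) ?nnegrE ?sqrtr_ge0// sqr_sqrtr.
apply: (@le_trans _ _ (`|h1 Tl| + `|g| * (`|h1 chi| + `|h2 chi|) + `|h2 Tr|)).
  have -> : h1 phi + h2 phi = h1 Tl + g * (h1 chi + h2 chi) + h2 Tr.
    by rewrite phi1 phi2; ring.
  rewrite (le_trans (ler_normD _ _))// lerD2r (le_trans (ler_normD _ _))//.
  by rewrite lerD2l normrM ler_wpM2l// ler_normD.
by rewrite /V lerD// lerD2r.
Qed.

End Blocks.

(** * Bounded functionals on far blocks and on late jumps *)

Section Functionals.
Variable R : realType.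
Implicit Types (x h : tspace R) (phi psi : test R).

Lemma dualZ (V : normedModType R) (f : dual_space V) a (x : V) : f (a *: x) = a * f x.
Proof. exact: linearZ. Qed.

Lemma ler_dual_norm (V : normedModType R) (f : dual_space V) (x : V) :
  `|f x| <= `|f| * `|x|.
Proof.
have [->|x0] := eqVneq x 0; first by rewrite linear0 normr0 mulr_ge0.
have nx0 : 0 < `|x| by rewrite normr_gt0.
have := @dual_norm_ub R V f (`|x|^-1 *: x); rewrite normfZV// lexx => /(_ isT).
by rewrite dualZ normrM normfV normr_id ler_pdivrMl// mulrC.
Qed.

(** In terms of b: it vanishes before time [n] and is back at 0 from time [p] on. *)
Definition zero_sum n p h := [/\ proj (lo R (before p)) h = h,
  proj (hi R (before n)) h = h & forall j, h (ltest R j) = 0].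

Lemma zero_sum_lin n p a h1 h2 :
  zero_sum n p h1 -> zero_sum n p h2 -> zero_sum n p (a *: h1 + h2).
Proof.
move=> [lo1 hi1 z1] [lo2 hi2 z2]; split.
- by rewrite linearP /= lo1 lo2.
- by rewrite linearP /= hi1 hi2.
- by move=> j; rewrite tfunD tfunZ z1 z2 mulr0 addr0.
Qed.

Lemma zero_sum0 n p : zero_sum n p 0.
Proof. by split; rewrite ?linear0. Qed.

Lemma zero_sumZ n p a h : zero_sum n p h -> zero_sum n p (a *: h).
Proof. by move=> zh; rewrite -[_ *: _]addr0; apply: zero_sum_lin zh (zero_sum0 _ _). Qed.

Lemma zero_sumD n p h1 h2 :
  zero_sum n p h1 -> zero_sum n p h2 -> zero_sum n p (h1 + h2).
Proof. by move=> *; rewrite -[h1]scale1r; exact: zero_sum_lin. Qed.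

Lemma zero_sum_sum n p I (r : seq I) (P : pred I) F :
  (forall i, P i -> zero_sum n p (F i)) -> zero_sum n p (\sum_(i <- r | P i) F i).
Proof.
by move=> FP; elim/big_rec: _ => [|i x Pi]; [exact: zero_sum0|apply: zero_sumD; exact: FP].
Qed.

Lemma zero_sum_widen n n' p p' h : (n' <= n)%N -> (p <= p')%N ->
  zero_sum n p h -> zero_sum n' p' h.
Proof.
move=> nn pp [loh hih zh]; split => //.
- rewrite -{1}loh (proj_comp (b := lo R (before p))) ?loh// => t _ /=.
  by case: (ltnP t p) => [tp|]; rewrite ?andbF ?andbT// (leq_trans tp).
- rewrite -{1}hih (proj_comp (b := hi R (before n))) ?hih// => t _ /=.
  by rewrite -!leqNgt; case: (leqP n t) => [tp|]; rewrite ?andbF ?andbT// (leq_trans nn).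
Qed.

(* Otherwise two successive unit blocks with values above [7/8 * eta] would have
   a sum of norm above [7/4], and [(7/4)^2 > 3]. *)
Lemma zero_sum_contract (f : dual_space (tspace R)) (eta : R) n : 0 <= eta ->
  (forall p h, zero_sum n p h -> `|f h| <= eta * `|h|) ->
  exists n', forall p h, zero_sum n' p h -> `|f h| <= 7/8 * eta * `|h|.
Proof.
move=> eta0 fn; apply: contrapT => /forallNP nfn.
have wit m : exists p h, [/\ zero_sum m p h, `|h| <= 1 & 7/8 * eta < f h].
  have /existsNP[p /existsNP[h /not_implyP[zh /negP]]] := nfn m.
  rewrite -ltNge => fh; exists p.
  have h0 : h != 0 by apply: contraTneq fh => ->; rewrite linear0 !normr0 mulr0 ltxx.
  have nh0 : 0 < `|h| by rewrite normr_gt0.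
  exists ((Num.sg (f h) * `|h|^-1) *: h); split; first exact: zero_sumZ.
    rewrite normrZ normrM normfV normr_id divfK ?gt_eqF// normr_sg.
    by case: (_ != 0).
  by rewrite dualZ [ltRHS]mulrAC -normrEsg ltr_pdivlMr.
have [p1 [h1 [zh1 h11 f1]]] := wit n.
(* The second block starts only after the end [p1] of the first. *)
have [p2 [h2 [zh2 h21 f2]]] := wit (maxn n p1).
have := fn (maxn p1 p2) (h1 + h2) _.
have zs12 : zero_sum n (maxn p1 p2) (h1 + h2).
  apply: zero_sumD; first exact: zero_sum_widen (leqnn _) (leq_maxl _ _) zh1.
  exact: zero_sum_widen (leq_maxl _ _) (leq_maxr _ _) zh2.
move=> /(_ zs12); rewrite linearD /=.
have [lo1 _ z1] := zh1.
have [_ hi2 z2] := zero_sum_widen (leq_maxr n p1) (leqnn _) zh2.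
have := two_blocks lo1 hi2 z1 z2 h11 h21.
set N := `|h1 + h2| => N3 fN.
have N0 : 0 <= N by rewrite normr_ge0.
have := le_trans (ler_norm _) fN.
have N74 : N < 7/4 by rewrite ltNge; apply/negP => N74; nra.
nra.
Qed.

Lemma zero_sum_small (f : dual_space (tspace R)) (e : R) : 0 < e ->
  exists n, forall p h, zero_sum n p h -> `|f h| <= e * `|h|.
Proof.
move=> e0.
have iter j : exists n, forall p h, zero_sum n p h ->
    `|f h| <= (7/8) ^+ j * `|f| * `|h|.
  elim: j => [|j [n fn]].
    by exists 0%N => p h _; rewrite expr0 mul1r ler_dual_norm.
  have [|n' fn'] := zero_sum_contract _ fn.
    by rewrite mulr_ge0// exprn_ge0.
  by exists n' => p h zh; rewrite exprS; have := fn' p h zh; rewrite !mulrA.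
have : (fun j => (7/8) ^+ j * `|f|) @ \oo --> (0 : R).
  rewrite -[X in _ --> X](mul0r `|f|); apply: cvgMr_tmp.
  by apply: cvg_expr; rewrite ger0_norm; lra.
move=> /cvgr_le /(_ _ e0) [j _ /(_ j (leqnn j)) /= fj].
have [n fn] := iter j; exists n => p h zh.
by rewrite (le_trans (fn _ _ zh))// ler_wpM2r.
Qed.

(* Even indices enumerate the coordinates of b, odd ones the coordinates of the
   summand c_0, whose vectors do not depend on [t]. *)
Definition jump t k := dvec R (if odd k then 0%N else t) k./2.

(** These tests are biorthogonal to the jumps at a late time: for [k./2 < t], [jump t k] takes the
    value 1 on [ltot k] and 0 on the other [ltot i]. *)
Definition ltot k : test R := if odd k then ztest R k./2 else ltest R k./2.

Lemma dvec_lo p t k : proj (lo R (before p)) (dvec R t k) =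
  if (0 < t < p)%N then dvec R t k else 0.
Proof. by rewrite proj_dvec. Qed.

Lemma dvec_hi p t k : proj (hi R (before p)) (dvec R t k) =
  if (0 < t)%N && (p <= t)%N then dvec R t k else 0.
Proof. by rewrite proj_dvec /= -leqNgt. Qed.

Lemma dvec_le1 t k : `|dvec R t k| <= 1.
Proof. by apply: tspace_norm_le => phi; rewrite dvecE test_le1. Qed.

(** The difference of two late jumps of the same coordinate is a far block with zero sum and norm at
    most 2. *)
Lemma jump_cvg (f : dual_space (tspace R)) k : cvg (f (jump t k) @[t --> \oo]).
Proof.
rewrite /jump; case: (odd k); first exact: is_cvg_cst.
apply: cauchy_cvg; apply: cauchy_exP => e e0.
have e40 : 0 < e / 4 by rewrite divr_gt0.
have [n fn] := zero_sum_small f e40.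
(* Beyond [k./2] the jump is admissible; earlier it would be the zero vector and the difference
   would not have zero sum. *)
set N := (maxn n k./2).+1; exists (f (dvec R N k./2)).
exists N => // t /= Nt; rewrite -ball_normE /ball_ /= -linearB /=.
have nN : (n < N)%N by rewrite ltnS leq_maxl.
have kN : (k./2 < N)%N by rewrite ltnS leq_maxr.
have zs : zero_sum n t.+1 (dvec R N k./2 - dvec R t k./2).
  split.
  - by rewrite linearB /= !dvec_lo (leq_ltn_trans _ nN)// ltnS Nt ltnSn (leq_trans _ Nt).
  - by rewrite linearB /= !dvec_hi (ltnW nN) (leq_trans _ Nt) ?(ltnW nN)// (leq_trans (ltnW nN) Nt).
  - by move=> j; rewrite tfunB /= kN (leq_trans kN Nt) subrr.
apply: le_lt_trans (fn _ _ zs) _.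
have : `|dvec R N k./2 - dvec R t k./2| <= 2.
  by rewrite (le_trans (ler_normB _ _))// (_ : 2 = 1 + 1)// lerD ?dvec_le1.
nra.
Qed.

Definition nu (f : dual_space (tspace R)) k : R := lim (f (jump t k) @[t --> \oo]).

Lemma nuP (f : dual_space (tspace R)) k : f (jump t k) @[t --> \oo] --> nu f k.
Proof. exact: jump_cvg. Qed.

Lemma jump_test_unique phi t : (0 < t)%N ->
  exists k0, forall k, k != k0 -> jump t k phi = 0.
Proof.
move=> t0; case: (testP phi) => [[pi [c [kappa [_ _ phiE]]]]|[j phiE]].
  exists (kappa (pi t)).*2 => k kk; rewrite /jump dvecE phiE /etest_fun.
  case: (boolP (odd k)) => // ok; case: ifP => // /andP[_ /eqP kE].
  by move: kk; rewrite -kE even_halfK ?eqxx.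
exists j.*2.+1 => k kk; rewrite /jump dvecE phiE /ztest_fun.
case: (boolP (odd k)) => ok; last by rewrite gtn_eqF.
rewrite eqxx /=; case: eqP => // kE.
by move: kk; rewrite -kE -[X in X != _]odd_double_half ok add1n eqxx.
Qed.

(** This is where values in c_0 matter: a test sees at most one of the jumps made at time [t], so
    their coefficients are measured by their maximum. *)
Lemma jump_sum_norm t K (c : nat -> R) (B : R) : (0 < t)%N -> 0 <= B ->
  (forall k, (k < K)%N -> `|c k| <= B) -> `|\sum_(k < K) c k *: jump t k| <= B.
Proof.
move=> t0 B0 cB; apply: tspace_norm_le => phi; rewrite tfun_sum.
have [k0 k0P] := jump_test_unique phi t0.
have [k0K|k0K] := ltnP k0 K; last first.
  rewrite big1 ?normr0// => k _; rewrite tfunZ k0P ?mulr0//.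
  by rewrite ltn_eqF// (leq_trans (ltn_ord k)).
rewrite (bigD1 (Ordinal k0K))// big1; last first.
  by move=> k kk0; rewrite tfunZ k0P ?mulr0.
rewrite -[X in `|X|]/(c k0 * jump t k0 phi + 0) addr0 normrM -[leRHS]mulr1 ler_pM// ?cB//.
by rewrite /jump dvecE test_le1.
Qed.

Lemma cvg_sum_ord K (u : nat -> nat -> R) (l : nat -> R) :
  (forall k, (k < K)%N -> u k t @[t --> \oo] --> l k) ->
  (\sum_(k < K) u k t) @[t --> \oo] --> \sum_(k < K) l k.
Proof.
elim: K => [_|K IH ul].
  rewrite big_ord0 (_ : (fun _ => _) = fun=> 0); first exact: cvg_cst.
  by apply/funext => t; rewrite big_ord0.
rewrite big_ord_recr (_ : (fun _ => _) = (fun t => \sum_(k < K) u k t + u K t)).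
  by apply: cvgD; [apply: IH => k kK; apply: ul; exact: ltnW|exact: ul].
by apply/funext => t; rewrite big_ord_recr.
Qed.

(** Duality between c_0 and l_1: at each time [t > 0], jumps with the signs of the [f (jump t k)]
    form a vector of norm at most 1. *)
Lemma sum_nu_le (f : dual_space (tspace R)) K : \sum_(k < K) `|nu f k| <= `|f|.
Proof.
have : (\sum_(k < K) `|f (jump t k)|) @[t --> \oo] --> \sum_(k < K) `|nu f k|.
  apply: (@cvg_sum_ord _ (fun k t => `|f (jump t k)|) (fun k => `|nu f k|)) => k _.
  by apply: cvg_norm; exact: nuP.
move=> cv; apply: (cvgr_to_le cv); exists 1%N => // t /= t0.
have -> : \sum_(k < K) `|f (jump t k)| = f (\sum_(k < K) Num.sg (f (jump t k)) *: jump t k).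
  by rewrite linear_sum; apply: eq_bigr => k _; rewrite /= dualZ -normrEsg.
rewrite (le_trans (ler_norm _))// (le_trans (ler_dual_norm _ _))//.
rewrite ler_piMr// (@jump_sum_norm _ _ (fun k => Num.sg (f (jump t k))))// => k _.
by rewrite normr_sg; case: (_ != 0).
Qed.

End Functionals.

(** * Cancelling the limits of a tail by one late jump *)

Section Decomposition.
Variable R : realType.
Implicit Types (x h : tspace R) (phi psi : test R).

Lemma dense_le (G : {linear tspace R -> R}) (C e : R) :
  (forall x, `|G x| <= C * `|x|) ->
  (forall n a, `|G (fcomb n a)| <= e * `|fcomb n a|) ->
  0 <= e -> forall x, `|G x| <= e * `|x|.
Proof.
move=> GC Ge e0 x; apply/ler_addgt0Pl => d d0.
have C0 : 0 <= `|C| by [].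
have s0 : 0 < `|C| + e + 1 by lra.
have [n [a xa]] := fcomb_dense x (divr_gt0 d0 s0).
rewrite -[X in G X](subrK (fcomb n a)) linearD /=.
have nx : `|fcomb n a| <= `|x| + d / (`|C| + e + 1).
  by rewrite -[X in `|X|](subKr x) (le_trans (ler_normB _ _))// lerD2l.
have := Ge n a; have := GC (x - fcomb n a).
have : `|G (x - fcomb n a) + G (fcomb n a)| <= _ := ler_normD _ _.
move=> h1 h2 h3.
have h4 : C * `|x - fcomb n a| <= `|C| * (d / (`|C| + e + 1)).
  by rewrite (le_trans (ler_wpM2r (normr_ge0 _) (ler_norm C)))// ler_wpM2l.
have h5 : e * `|fcomb n a| <= e * (`|x| + d / (`|C| + e + 1)) by rewrite ler_wpM2l.
have dE : d = (`|C| + e + 1) * (d / (`|C| + e + 1)) by rewrite mulrC divfK// gt_eqF.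
have d1 : 0 < d / (`|C| + e + 1) by exact: divr_gt0.
set q := d / _ in dE d1 h4 h5 *.
nra.
Qed.

Lemma fcomb_widen n m a : (n <= m)%N -> exists a', fcomb n a = @fcomb R m a'.
Proof.
move=> nm; exists (fun t k => if (t < n)%N && (k < n)%N then a t k else 0).
by apply/val_inj/funext => phi; rewrite /= !fcombE (comb_widen _ nm).
Qed.

Lemma sum_jump_ltot x t p (s k : nat) : (s < p)%N -> (k < p)%N -> (s <= k)%N = false \/ s = 0%N ->
  \sum_(i < p.*2) dvec R s k (ltot R i) *: jump R t i =
  dvec R (if s == 0 then 0 else t)%N k.
Proof.
move=> sp kp sk; set i0 := (k.*2 + (s == 0))%N.
have i0p : (i0 < p.*2)%N.
  rewrite /i0; case: eqP => _ /=; rewrite ?addn0 ?ltn_double//.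
  by rewrite addn1 -doubleS leq_double.
have oi0 : odd i0 = (s == 0)%N by rewrite oddD odd_double; case: eqP.
have hi0 : i0./2 = k by rewrite /i0 halfD odd_double doubleK; case: eqP; rewrite ?addn0.
rewrite (bigD1 (Ordinal i0p))//= big1 ?addr0.
  rewrite /jump /ltot oi0 hi0; have [s0|s0] := eqVneq s 0%N.
    by rewrite s0 /= /ztest_fun /= eqxx scale1r.
  rewrite /= eqxx andbT ltnNge; case: sk => [->|/eqP]; last by rewrite (negbTE s0).
  by rewrite scale1r.
move=> i; rewrite -val_eqE /= => ii0; rewrite (_ : ltot R i s k = 0) ?scale0r//.
rewrite /ltot; case: ifPn => oi /=.
  rewrite /ztest_fun; case: eqP => //= s0; case: eqP => // ki.
  case/eqP: ii0; rewrite /i0 s0 ki -[LHS]odd_double_half oi addnC.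
  by rewrite eqxx.
case: ltnP => //= ks; case: eqP => // ki; case/eqP: ii0.
rewrite /i0 ki even_halfK// (_ : (s == 0)%N = false) ?addn0//.
by apply/negbTE; rewrite -lt0n (leq_ltn_trans _ ks).
Qed.

(** [u] keeps time 0 and the times from [n] on. Each of its jumps is paired with the opposite jump
    at time [t], admissible since [p <= t]; the terms at time 0 cancel exactly. By linearity a
    single [dvec] is enough. *)
Lemma tail_zero_sum n p t a : (n <= p)%N -> (p <= t)%N ->
  let u := fcomb p a - proj (lo R (before n)) (fcomb p a) in
  zero_sum n t.+1 (u - \sum_(i < p.*2) u (ltot R i) *: jump R t i).
Proof.
move=> np pt u.
pose A x := (x - proj (lo R (before n)) x)
  - \sum_(i < p.*2) (x - proj (lo R (before n)) x) (ltot R i) *: jump R t i.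
have AP : linear A.
  move=> b x y; rewrite /A.
  have -> z w : b *: z + w - proj (lo R (before n)) (b *: z + w) =
      b *: (z - proj (lo R (before n)) z) + (w - proj (lo R (before n)) w).
    by rewrite linearP /= scalerBr opprD addrACA.
  move: (x - _) (y - _) => X Y.
  have -> : \sum_(i < p.*2) (b *: X + Y) (ltot R i) *: jump R t i =
      b *: (\sum_(i < p.*2) X (ltot R i) *: jump R t i)
      + \sum_(i < p.*2) Y (ltot R i) *: jump R t i.
    rewrite scaler_sumr -big_split /=; apply: eq_bigr => i _.
    by rewrite scalerA -scalerDl.
  by rewrite scalerBr opprD addrACA.
pose Al : {linear tspace R -> tspace R} := HB.pack A
  (GRing.isLinear.Build R (tspace R) (tspace R) *:%R A AP).
rewrite -[X in zero_sum _ _ X]/(Al (fcomb p a)) /fcomb linear_sum.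
apply: zero_sum_sum => s _; rewrite linear_sum; apply: zero_sum_sum => k _.
rewrite linearZ; apply: zero_sumZ; rewrite /= /A dvec_lo.
have sp := ltn_ord s; have kp := ltn_ord k.
have [sn|sn] := boolP (0 < s < n)%N.
  rewrite subrr big1 ?subr0; first exact: zero_sum0.
  by move=> i _; rewrite tfun0 scale0r.
rewrite !subr0.
have [s0|s0] := eqVneq (s : nat) 0%N.
  by rewrite sum_jump_ltot//; [rewrite s0 subrr; exact: zero_sum0|right].
have [sk|sk] := boolP (s <= k)%N.
  have -> : dvec R s k = 0.
    by apply/val_inj/funext => phi; rewrite /= test_adm// lt0n.
  rewrite big1 ?subr0; first exact: zero_sum0.
  by move=> i _; rewrite tfun0 scale0r.
rewrite sum_jump_ltot//; last by left; exact/negbTE.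
rewrite (negbTE s0).
have s1 : (0 < s)%N by rewrite lt0n.
have ns : (n <= s)%N by move: sn; rewrite s1 /= -leqNgt.
have st : (s < t)%N by exact: leq_trans pt.
have kt : (k < t)%N by exact: leq_trans pt.
have t1 : (0 < t)%N by exact: leq_ltn_trans st.
split.
- by rewrite linearB /= !dvec_lo s1 t1 ltnSn ltnS ltnW.
- by rewrite linearB /= !dvec_hi s1 t1 ns (leq_trans ns)// ltnW.
- by move=> j; rewrite tfunB /= kt ltnNge sk subrr.
Qed.

Lemma nondecreasing_bounded_flat (v : nat -> R) (B e : R) :
  nondecreasing_seq v -> (forall n, v n <= B) -> 0 < e ->
  exists K, forall L, (K <= L)%N -> v L - v K <= e.
Proof.
move=> vnd vB e0; have vs : has_sup (range v).
  by split; [exists (v 0%N), 0%N|exists B => _ [n _ <-]].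
have [_ [K _ <-] vK] := sup_adherent e0 vs.
exists K => L KL; rewrite lerBlDr -lerBlDl (le_trans _ (ltW vK))// lerD2r.
by apply: sup_upper_bound => //; exists L.
Qed.

Lemma sum_nu_tail (f : dual_space (tspace R)) (e : R) : 0 < e ->
  exists K, forall L, (K <= L)%N -> \sum_(K <= k < L) `|nu f k| <= e.
Proof.
move=> e0; pose v L : R := \sum_(0 <= k < L) `|nu f k|.
have vnd : nondecreasing_seq v.
  by apply/nondecreasing_seqP => L; rewrite /v big_nat_recr //= lerDl.
have vB L : v L <= `|f| by rewrite /v big_mkord sum_nu_le.
have [K Kv] := nondecreasing_bounded_flat vnd vB e0.
exists K => L KL; apply: le_trans (Kv _ KL).
by rewrite /v (big_cat_nat (leq0n K) KL) /= addrAC subrr add0r.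
Qed.

End Decomposition.

(** * Building functionals from bounds *)

Section BoundedFunctional.
Variables (R : realType) (V : normedModType R).

Lemma bounded_functional (g : V -> R) (C : R) : linear g ->
  (forall x, `|g x| <= C * `|x|) -> g \in @continuous_functional R V.
Proof.
move=> gl gC; apply/asboolP; split => //.
pose gL : {linear V -> R} := HB.pack g (GRing.isLinear.Build R V R *:%R g gl).
apply: (@bounded_linear_continuous R V R gL).
apply/linear_boundedP; exists `|C|; split; first exact: num_real.
move=> r Cr x; rewrite (le_trans (gC x))// ler_wpM2r//.
by rewrite (le_trans (ler_norm C))// ltW.
Qed.

Definition bfun (g : V -> R) (C : R) (gl : linear g)
    (gC : forall x, `|g x| <= C * `|x|) : dual_space V :=
  DualSpace (bounded_functional gl gC).

Lemma dual_space_norm_le (f : dual_space V) (C : R) : 0 <= C ->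
  (forall x, `|f x| <= C * `|x|) -> `|f| <= C.
Proof.
move=> C0 fC; apply: dual_norm_le => x x1.
by rewrite (le_trans (fC x))// ler_piMr.
Qed.

Lemma dualD (f g : dual_space V) x : (f + g) x = f x + g x. Proof. by []. Qed.

Lemma dualB (f g : dual_space V) x : (f - g) x = f x - g x. Proof. by []. Qed.

Lemma dual_scale a (f : dual_space V) x : (a *: f) x = a * f x. Proof. by []. Qed.

Lemma dual_sum I (r : seq I) (P : pred I) (F : I -> dual_space V) x :
  (\sum_(i <- r | P i) F i) x = \sum_(i <- r | P i) F i x.
Proof. by elim/big_rec2: _ => // i y z _ <-. Qed.

Lemma dual_ext (f g : dual_space V) : f =1 g -> f = g.
Proof. by move=> fg; apply/val_inj/funext. Qed.

End BoundedFunctional.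

(** * The decomposition of the dual of X *)

Section Approximation.
Variable R : realType.
Implicit Types (x h : tspace R) (phi psi : test R) (f : dual_space (tspace R)).

Lemma ev_linear phi : linear (fun x => x phi).
Proof. by []. Qed.

Lemma ev_bounded phi x : `|x phi| <= 1 * `|x|.
Proof. by rewrite mul1r tspace_norm. Qed.

Definition ev phi : dual_space (tspace R) := bfun (ev_linear phi) (ev_bounded phi).

Lemma evE phi x : ev phi x = x phi. Proof. by []. Qed.

Lemma ev_norm phi : `|ev phi| <= 1.
Proof. by apply: dual_space_norm_le => // x; exact: ev_bounded. Qed.

Lemma fproj_linear (b : tmask R) f : linear (fun x => f (proj b x)).
Proof. by move=> a x y; rewrite linearP linearP. Qed.

Lemma fproj_bounded (b : tmask R) f x : `|f (proj b x)| <= `|f| * `|x|.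
Proof. by rewrite (le_trans (ler_dual_norm _ _))// ler_wpM2l// proj_norm. Qed.

Definition fproj b f : dual_space (tspace R) :=
  bfun (fproj_linear b f) (fproj_bounded b f).

Lemma fprojE b f x : fproj b f x = f (proj b x). Proof. by []. Qed.

Lemma fproj_norm b f : `|fproj b f| <= `|f|.
Proof. by apply: dual_space_norm_le => // x; exact: fproj_bounded. Qed.

(** Truncation of the three components of [f]: the part in [Y] sees times below [n], and the first
    [K] limit and c_0 functionals, with coefficients [nu f k], act on the rest. *)
Definition approx f n K : dual_space (tspace R) :=
  fproj (lo R (before n)) f
  + \sum_(k < K) nu f k *: (ev (ltot R k) - fproj (lo R (before n)) (ev (ltot R k))).

Lemma approxE f n K x : approx f n K x = f (proj (lo R (before n)) x)
  + \sum_(k < K) nu f k * (x - proj (lo R (before n)) x) (ltot R k).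
Proof. by rewrite /approx dualD dual_sum. Qed.

Lemma approx_dual f (e : R) n0 K0 : 0 < e -> exists n K,
  [/\ (n0 <= n)%N, (K0 <= K)%N & `|f - approx f n K| <= e].
Proof.
move=> e0.
(* [e / 8] will act on a block of norm at most [4 * |x|], and [e / 4] on coefficients of size at
   most [2 * |x|]; each contributes half of [e]. *)
have e80 : 0 < e / 8 by rewrite divr_gt0.
have e40 : 0 < e / 4 by rewrite divr_gt0.
have [n1 fn1] := zero_sum_small f e80; set n := maxn n0 n1.
have [K1 fK1] := sum_nu_tail f e40; set K := maxn K0 K1.
exists n, K; split; rewrite ?leq_maxl//.
apply: dual_space_norm_le; first exact: ltW.
apply: (dense_le (C := `|f - approx f n K|)); [by move=> x; exact: ler_dual_norm| |exact: ltW].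
move=> m a; set x := fcomb m a.
set p := maxn m (maxn n K).
have [a' xE] : exists a', x = fcomb p a' by apply: fcomb_widen; rewrite leq_maxl.
have np : (n <= p)%N by rewrite /p leq_max leq_maxl orbT.
have Kp : (K <= p)%N by rewrite /p leq_max leq_maxr orbT.
pose u := x - proj (lo R (before n)) x.
have un : `|u| <= 2 * `|x|.
  rewrite (le_trans (ler_normB _ _))// mulr_natl mulr2n lerD2l.
  exact: proj_norm.
(* With [nu f i] replaced by [f (jump R t i)], [f] is evaluated on a far block with zero sum; then
   [t] tends to infinity. *)
have main : `|f u - \sum_(i < p.*2) u (ltot R i) * nu f i| <= e / 2 * `|x|.
  have cv : `|f u - \sum_(i < p.*2) u (ltot R i) * f (jump R t i)| @[t --> \oo] -->
      `|f u - \sum_(i < p.*2) u (ltot R i) * nu f i|.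
    apply: cvg_norm; apply: cvgB; first exact: cvg_cst.
    apply: (@cvg_sum_ord R _ (fun i t => u (ltot R i) * f (jump R t i))
      (fun i => u (ltot R i) * nu f i)) => i _.
    by apply: cvgMl_tmp; exact: nuP.
  apply: (cvgr_to_le cv); exists p.+1 => // t /= pt.
  have -> : f u - \sum_(i < p.*2) u (ltot R i) * f (jump R t i) =
      f (u - \sum_(i < p.*2) u (ltot R i) *: jump R t i).
    rewrite [RHS]linearB; congr (_ - _).
    by rewrite [RHS]linear_sum; apply: eq_bigr => i _; rewrite /= dualZ.
  have zs : zero_sum n1 t.+1 (u - \sum_(i < p.*2) u (ltot R i) *: jump R t i).
    apply: (zero_sum_widen (leq_maxr n0 n1) (leqnn _)).
    by rewrite /u xE; apply: tail_zero_sum => //; exact: ltnW.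
  rewrite (le_trans (fn1 _ _ zs))//.
  have : `|u - \sum_(i < p.*2) u (ltot R i) *: jump R t i| <= 4 * `|x|.
    rewrite (le_trans (ler_normB _ _))// (_ : 4 * `|x| = 2 * `|x| + 2 * `|x|); last by ring.
    apply: lerD; [exact: un|apply: (@jump_sum_norm R t _ (fun i => u (ltot R i)))].
    - by rewrite (leq_ltn_trans _ pt).
    - by rewrite mulr_ge0.
    - by move=> i _; rewrite (le_trans (tspace_norm _ _)).
  have nx := normr_ge0 x; nra.
have tail : `|\sum_(K <= i < p.*2) u (ltot R i) * nu f i| <= e / 2 * `|x|.
  rewrite (le_trans (ler_norm_sum _ _ _))//.
  apply: (@le_trans _ _ (\sum_(K <= i < p.*2) 2 * `|x| * `|nu f i|)).
    apply: ler_sum => i _; rewrite normrM ler_wpM2r//.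
    by rewrite (le_trans (tspace_norm _ _)).
  rewrite -mulr_sumr.
  have Kp2 : (K <= p.*2)%N by rewrite (leq_trans Kp)// -addnn leq_addr.
  have h1 : \sum_(K <= i < p.*2) `|nu f i| <= e / 4.
    have := fK1 p.*2 (leq_trans (leq_maxr _ _) Kp2).
    rewrite (big_cat_nat (leq_maxr K0 K1) Kp2) /=; apply: le_trans.
    by rewrite lerDr sumr_ge0.
  have nx := normr_ge0 x; nra.
rewrite -[X in `|X|]/((f - approx f n K) x).
have -> : (f - approx f n K) x = f u - \sum_(i < K) u (ltot R i) * nu f i.
  rewrite dualB approxE opprD addrA /u linearB; congr (_ - _).
  by apply: eq_bigr => k _; rewrite mulrC.
have sumE : \sum_(i < p.*2) u (ltot R i) * nu f i =
    \sum_(i < K) u (ltot R i) * nu f i + \sum_(K <= i < p.*2) u (ltot R i) * nu f i.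
  rewrite -[in LHS](big_mkord xpredT (fun i => u (ltot R i) * nu f i)).
  rewrite -(big_mkord xpredT (fun i => u (ltot R i) * nu f i)) -big_cat_nat//=.
  by rewrite (leq_trans Kp)// -addnn leq_addr.
have -> : f u - \sum_(i < K) u (ltot R i) * nu f i =
    (f u - \sum_(i < p.*2) u (ltot R i) * nu f i)
    + \sum_(K <= i < p.*2) u (ltot R i) * nu f i by rewrite sumE; ring.
by rewrite (le_trans (ler_normD _ _))// [e in leRHS]splitr mulrDl lerD.
Qed.

End Approximation.

(** * The Hahn-Banach theorem by minimal sublinear functionals *)

Section HahnBanach.
Variables (R : realType) (V : lmodType R).
Implicit Types q : V -> R.

Definition sublinear q := (forall v w, q (v + w) <= q v + q w) /\
  (forall t v, 0 < t -> q (t *: v) <= t * q v).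

Lemma sublinear0 q : sublinear q -> q 0 = 0.
Proof.
move=> [_ qZ]; have := qZ 2 0 (ltr0Sn R 1); rewrite scaler0.
have := qZ (2^-1) 0; rewrite invr_gt0 ltr0Sn scaler0 => /(_ isT); lra.
Qed.

Lemma sublinear_opp q v : sublinear q -> - q (- v) <= q v.
Proof.
move=> sq; have := sq.1 v (- v); rewrite subrr sublinear0//; lra.
Qed.

Section Inf.
Variables (I : Type) (i0 : I) (F : I -> V -> R) (l : V -> R).
Hypothesis lF : forall i v, l v <= F i v.

Definition infF v := inf (range (F ^~ v)).

Lemma infF_le i v : infF v <= F i v.
Proof.
apply: ge_inf; last by exists i.
by exists (l v) => _ [j _ <-].
Qed.

Lemma le_infF v y : (forall i, y <= F i v) -> y <= infF v.
Proof.
move=> yF; apply: lb_le_inf; first by exists (F i0 v), i0.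
by move=> _ [j _ <-].
Qed.

Lemma infF_sublinear :
  (forall i j v w, exists k, F k (v + w) <= F i v + F j w) ->
  (forall i t v, 0 < t -> exists k, F k (t *: v) <= t * F i v) -> sublinear infF.
Proof.
move=> FD FZ; split=> [v w|t v t0].
  rewrite -lerBlDr; apply: le_infF => i; rewrite lerBlDr -lerBlDl.
  apply: le_infF => j; rewrite lerBlDl; have [k] := FD i j v w.
  by apply: le_trans; exact: infF_le.
rewrite -ler_pdivrMl//; apply: le_infF => i; rewrite ler_pdivrMl//.
by have [k] := FZ i t v t0; apply: le_trans; exact: infF_le.
Qed.

End Inf.

(* Compare [q] with [v |-> inf_(t >= 0) (q (v + t w) - t q w)]. *)
Lemma minimal_sublinear_linear q : sublinear q ->
  (forall q', sublinear q' -> (forall v, q' v <= q v) -> forall v, q v <= q' v) ->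
  linear q.
Proof.
move=> sq qmin.
have qD v w : q (v + w) = q v + q w.
  apply/eqP; rewrite eq_le sq.1 /=.
  pose F (t : R) v := q (v + `|t| *: w) - `|t| * q w.
  have lF t u : - q (- u) <= F t u.
    rewrite /F; have := sq.1 (u + `|t| *: w) (- u); rewrite addrAC subrr add0r.
    have [->|t0] := eqVneq t 0.
      by rewrite normr0 scale0r sublinear0// mul0r addr0; lra.
    have : 0 < `|t| by rewrite normr_gt0.
    move=> t1; have := sq.2 `|t|^-1 (`|t| *: w); rewrite invr_gt0 => /(_ t1).
    by rewrite scalerA mulVf ?normr_eq0// scale1r ler_pdivlMl//; lra.
  have infs : sublinear (infF F).
    apply: (infF_sublinear 0 lF) => [s t u z|s t u t0].
      exists (`|s| + `|t|); rewrite /F ger0_norm ?addr_ge0// scalerDl addrACA.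
      have := sq.1 (u + `|s| *: w) (z + `|t| *: w); lra.
    exists (t * `|s|); rewrite /F normrM normr_id (gtr0_norm t0) -scalerA -scalerDr.
    have := sq.2 t (u + `|s| *: w) t0; lra.
  have infq u : infF F u <= q u.
    by apply: le_trans (infF_le lF 0 u) _; rewrite /F normr0 scale0r addr0 mul0r subr0.
  have := qmin _ infs infq v; have := infF_le lF 1 v.
  rewrite /F normr1 scale1r mul1r; lra.
have qN v : q (- v) = - q v.
  by apply/eqP; rewrite -addr_eq0 -qD addrC subrr sublinear0.
have qZ t v : 0 < t -> q (t *: v) = t * q v.
  move=> t0; apply/eqP; rewrite eq_le sq.2//=.
  have := sq.2 t^-1 (t *: v); rewrite invr_gt0 => /(_ t0).
  by rewrite scalerA mulVf ?gt_eqF// scale1r ler_pdivlMl.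
move=> a v w; rewrite qD; congr (_ + _).
have [a0|a0|->] := ltrgt0P a; first exact: qZ.
  by rewrite -[a]opprK scaleNr qN qZ ?oppr_gt0// -scaleNr.
by rewrite !scale0r sublinear0.
Qed.

(** Zorn's lemma downwards. Any sublinear functional below [p] is above [- p (- v)], so the
    pointwise infimum of a chain is finite, and comparability of the members makes it sublinear. *)
Lemma sublinear_dominates_linear p : sublinear p ->
  exists2 q : V -> R, linear q & forall v, q v <= p v.
Proof.
move=> sp; pose T := {q : V -> R | sublinear q /\ forall v, q v <= p v}.
pose le (q q' : T) := `[< forall v, sval q' v <= sval q v >].
have pP : sublinear p /\ forall v, p v <= p v by [].
have [|||A Atot|q qmax] := @Zorn T le.
- by move=> q; apply/asboolP.
- move=> q1 q2 q3 /asboolP h1 /asboolP h2; apply/asboolP => v.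
  exact: le_trans (h2 v) (h1 v).
- move=> [q1 P1] [q2 P2] /asboolP h1 /asboolP h2.
  have E : q1 = q2 by apply/funext => v; apply/eqP; rewrite eq_le h1 h2.
  by move: P1 P2 h1 h2; rewrite E => P1 P2 _ _; rewrite (Prop_irrelevance P1 P2).
- have [[a Aa]|A0] := pselect (exists a, A a); last first.
    by exists (exist _ p pP) => s As; case: A0; exists s.
  pose F (i : {a : T | A a}) := sval (sval i).
  have lF i v : - p (- v) <= F i v.
    case: i => [[q [sq qp]] Aq]; rewrite /F /=.
    by rewrite (le_trans _ (sublinear_opp v sq))// lerN2.
  have i0 : {a : T | A a} by exists a.
  have infs : sublinear (infF F).
    apply: (infF_sublinear i0 lF) => [i j v w|i t v t0]; last first.
      by exists i; case: i => [[q [sq qp]] Aq]; exact: sq.2.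
    have [ij|ji] := Atot _ _ (svalP i) (svalP j).
      exists j; apply: le_trans ((svalP (sval j)).1.1 v w) _.
      by rewrite lerD2r; move/asboolP: ij; exact.
    exists i; apply: le_trans ((svalP (sval i)).1.1 v w) _.
    by rewrite lerD2l; move/asboolP: ji; exact.
  have infp v : infF F v <= p v.
    by apply: le_trans (infF_le lF i0 v) _; exact: (svalP (sval i0)).2.
  exists (exist _ (infF F) (conj infs infp) : T) => s As; apply/asboolP => v /=.
  exact: (infF_le lF (exist _ s As) v).
exists (sval q); last exact: (svalP q).2.
apply: minimal_sublinear_linear; first exact: (svalP q).1.
move=> q' sq' q'q v.
have q'p u : q' u <= p u by apply: le_trans (q'q u) ((svalP q).2 u).
by have <- := qmax (exist _ q' (conj sq' q'p) : T) (asboolT q'q).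
Qed.

End HahnBanach.

Lemma hahn_banach (R : realType) (V : normedModType R) (W : lmodType R)
    (T : {linear W -> V}) (g : {linear W -> R}) (B : R) : 0 <= B ->
  (forall w, `|g w| <= B * `|T w|) ->
  exists q : V -> R, [/\ linear q, (forall v, `|q v| <= B * `|v|)
    & forall w, q (T w) = g w].
Proof.
move=> B0 gB; (* The infimum of [F] is at most [B * `|v|], and at most [g] on the range. *)
pose F (w : W) v := g w + B * `|v - T w|.
have lF w v : - (B * `|v|) <= F w v.
  rewrite /F; have := gB w; rewrite ler_norml => /andP[gw _].
  have : B * `|T w| <= B * (`|v| + `|v - T w|).
    by rewrite ler_wpM2l// -[X in `|X|](subKr v) ler_normB.
  lra.
have sF : sublinear (infF F).
  apply: (infF_sublinear 0 lF) => [i j v w|i t v t0].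
    exists (i + j); rewrite /F (linearD g) (linearD T) opprD [v + w + _]addrACA.
    by rewrite [leRHS]addrACA lerD2l -mulrDr ler_wpM2l// ler_normD.
  exists (t *: i); rewrite /F [g _]linearZ [T _]linearZ /= -scalerBr normrZ (gtr0_norm t0).
  by rewrite mulrDr mulrCA.
have [q ql qF] := sublinear_dominates_linear sF.
have qF' w v : q v <= g w + B * `|v - T w|.
  exact: le_trans (qF v) (infF_le lF w v).
have qN v : q (- v) = - q v.
  pose qL : {linear V -> R} := HB.pack q (GRing.isLinear.Build R V R *:%R q ql).
  exact: (linearN qL).
have qb v : q v <= B * `|v|.
  by have := qF' 0 v; rewrite !linear0 addr0 add0r.
have qT w : q (T w) <= g w by have := qF' w (T w); rewrite subrr normr0 mulr0 addr0.
exists q; split => //.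
  by move=> v; rewrite ler_norml qb andbT lerNl -qN -normrN qb.
move=> w; apply/eqP; rewrite eq_le qT /=.
by have := qT (- w); rewrite !linearN /= qN lerN2.
Qed.

(** * The elements of the bidual of X *)

Section WeakStarLimit.
Variable R : realType.
Implicit Types (x h : tspace R) (phi psi : test R) (f : dual_space (tspace R)).

(** The jump coordinate: a limit functional masked to the single time [t]. *)
Definition ctest t k : test R :=
  mtest (lo R (before t.+1)) (mtest (hi R (before t)) (ltest R k)).

Lemma ctestE t k s j :
  ctest t k s j = ((0 < s) && (s == t) && (k < s) && (j == k))%N%:R.
Proof.
rewrite /= /mask_fun /=; case: (ltnP 0 s) => //= s0.
rewrite ltnS -leqNgt [s == t]eqn_leq; case: (leqP s t) => //= st.
by case: (leqP t s) => //= ts; case: eqP => [->|]; rewrite ?andbF.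
Qed.

Lemma mtest_lo_sum n phi s j : mtest (lo R (before n)) phi s j =
  \sum_(p : 'I_n * 'I_n) phi p.1 p.2 * ctest p.1 p.2 s j.
Proof.
rewrite mtestE; case: ifPn => [/andP[s0 sn]|sn]; last first.
  rewrite big1// => -[t k] _; rewrite ctestE /=; case: eqP => [st|]; last first.
    by rewrite andbF mulr0.
  by move: sn; rewrite /= st ltn_ord andbT => /negbTE ->; rewrite mulr0.
have {}sn : (s < n)%N by [].
have [js|js] := ltnP j s; last first.
  rewrite test_adm// big1// => -[t k] _; rewrite ctestE /=.
  case: (ltnP k s) => ks; last by rewrite !andbF mulr0.
  by rewrite (_ : (j == k)%N = false) ?andbF ?mulr0// gtn_eqF// (leq_trans ks).
have jn := ltn_trans js sn.
rewrite (bigD1 (Ordinal sn, Ordinal jn))// big1; last first.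
  move=> -[t k]; rewrite ctestE /= xpair_eqE negb_and => tk.
  case: eqP => [st|]; last by rewrite andbF mulr0.
  case: (eqVneq j k) => [jk|]; last by rewrite andbF mulr0.
  by move: tk; rewrite -!val_eqE /= -st -jk !eqxx.
by rewrite ctestE /= s0 js !eqxx mulr1 addr0.
Qed.

(** The support condition gives finite rank: before time [n] only coordinates below [n] can jump. *)
Lemma proj_lo_sum n x : proj (lo R (before n)) x =
  \sum_(p : 'I_n * 'I_n) x (ctest p.1 p.2) *: dvec R p.1 p.2.
Proof.
apply/val_inj/funext => phi; rewrite /= -[RHS]/((\sum_p _ : tspace R) phi) tfun_sum.
rewrite (tfun_lin x (mtest_lo_sum n phi)); apply: eq_bigr => p _.
by rewrite tfunZ dvecE mulrC.
Qed.

Lemma fproj_lo_sum n f : fproj (lo R (before n)) f =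
  \sum_(p : 'I_n * 'I_n) f (dvec R p.1 p.2) *: ev (ctest p.1 p.2).
Proof.
apply: dual_ext => x; rewrite fprojE proj_lo_sum dual_sum [LHS]linear_sum.
by apply: eq_bigr => p _; rewrite [LHS]dualZ mulrC.
Qed.

Lemma everything_subproof s t : (s <= t)%N -> true -> true.
Proof. by []. Qed.

(** As masks erase time 0, [proj (lo R everything)] is the projection onto E along c_0. *)
Definition everything := Cut everything_subproof.

(** Both masks erase time 0; the hypothesis says that [x] has no component in c_0. *)
Lemma proj_hi_lo m m' x : proj (lo R m') x = x ->
  proj (hi R m) x = x - proj (lo R m) x.
Proof.
move=> mx; apply/eqP; rewrite eq_sym subr_eq; apply/eqP/val_inj/funext => phi.
rewrite -[RHS]/((proj (hi R m) x + proj (lo R m) x) phi) tfunD !projE.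
rewrite -[x (mtest (hi R m) phi)]mul1r -[x (mtest (lo R m) phi)]mul1r.
apply: (tfun_lin2_on mx) => t k t0 _; rewrite !mtestE t0 /=.
by case: (m t); rewrite /= !mul1r ?add0r ?addr0.
Qed.

Lemma eq_of_norm_small x h : (forall d : R, 0 < d -> `|x - h| <= d) -> x = h.
Proof.
move=> xh; apply/eqP; rewrite -subr_eq0 -normr_le0.
by apply/ler_addgt0Pl => d d0; rewrite addr0; exact: xh.
Qed.

Section Psi.
(* [e_ n] is the truncation at time [n] of the component of [Psi] in E. *)
Variables (Psi : {linear dual_space (tspace R) -> R}) (B : R).
Hypotheses (B0 : 0 <= B) (PsiB : forall f, `|Psi f| <= B * `|f|).

Let e_ n : tspace R := \sum_(p : 'I_n * 'I_n) Psi (ev (ctest p.1 p.2)) *: dvec R p.1 p.2.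

Let f_e_ f n : f (e_ n) = Psi (fproj (lo R (before n)) f).
Proof.
rewrite fproj_lo_sum /e_ !linear_sum; apply: eq_bigr => p _.
by rewrite [LHS]dualZ [RHS]linearZ /= mulrC.
Qed.

Let e_norm n : `|e_ n| <= B.
Proof.
apply: tspace_norm_le => phi; rewrite -evE f_e_ (le_trans (PsiB _))//.
by rewrite ler_piMr// (le_trans (fproj_norm _ _))// ev_norm.
Qed.

Let proj_e n m : (n <= m)%N -> proj (lo R (before n)) (e_ m) = e_ n.
Proof.
move=> nm; apply/val_inj/funext => phi.
rewrite -[RHS]/(ev phi (e_ n)) -[LHS]/(fproj (lo R (before n)) (ev phi) (e_ m)).
rewrite !f_e_; congr (Psi _); apply: dual_ext => x; rewrite !fprojE.
rewrite (proj_comp (b := lo R (before n)))// => t _ /=.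
by case: (ltnP t n) => // tn; rewrite (leq_trans tn).
Qed.

(** E is boundedly complete: by the lower 2-estimate, the squared distance of two truncations is at
    most the increase of the squared norm, which is monotone and bounded. *)
Let e_cauchy (d : R) : 0 < d ->
  exists K, forall L, (K <= L)%N -> `|e_ L - e_ K| <= d.
Proof.
move=> d0; pose v n := `|e_ n| ^+ 2.
have vnd : nondecreasing_seq v.
  by move=> n m nm; rewrite /v ler_sqr ?nnegrE// -(proj_e nm) proj_norm.
have vB n : v n <= B ^+ 2 by rewrite /v ler_sqr ?nnegrE.
have d20 : 0 < d ^+ 2 by rewrite exprn_gt0.
have [K Kv] := nondecreasing_bounded_flat vnd vB d20.
exists K => L KL; rewrite -ler_sqr ?nnegrE ?(ltW d0)//.
apply: le_trans (Kv _ KL); rewrite lerBrDl /v.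
rewrite -{1}(proj_e KL) -[X in e_ L - X](proj_e KL) -(proj_hi_lo _ (proj_e (leqnn L))).
exact: lo_hi_sqr.
Qed.

Let e_limit : exists e, [/\ `|e| <= B, proj (lo R everything) e = e
  & forall d : R, 0 < d -> exists N, forall n, (N <= n)%N -> `|e - e_ n| <= d].
Proof.
have ce : cvg (e_ @ \oo).
  apply: cauchy_cvg; apply: cauchy_exP => d d0.
  have [|K KL] := @e_cauchy (d / 2); first by rewrite divr_gt0.
  exists (e_ K), K => // L /= LK; rewrite -ball_normE /ball_ /= distrC.
  by rewrite (le_lt_trans (KL _ LK))// ltr_pdivrMr// ltr_pMr// ltr1n.
have near_e (d : R) : 0 < d -> exists N, forall n, (N <= n)%N -> `|lim (e_ @ \oo) - e_ n| <= d.
  move=> d0; have /cvgrPdist_le /(_ _ d0) [N _ HN] := ce.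
  by exists N => n; exact: HN.
exists (lim (e_ @ \oo)); split => //.
  apply/ler_addgt0Pl => d d0; have [N /(_ N (leqnn N)) dN] := near_e d d0.
  by rewrite -[X in `|X|](subrK (e_ N)) (le_trans (ler_normD _ _))// lerD.
apply: eq_of_norm_small => d d0.
have [|N /(_ N (leqnn N)) dN] := near_e (d / 2); first by rewrite divr_gt0.
set e := lim _ in dN *.
have -> : proj (lo R everything) e - e = proj (lo R everything) (e - e_ N) - (e - e_ N).
  rewrite linearB /= -{1}(proj_e (leqnn N)) (proj_comp (b := lo R (before N)))//.
  by rewrite proj_e//; rewrite opprB addrA subrK.
rewrite (le_trans (ler_normB _ _))// [leRHS]splitr lerD//.
by rewrite (le_trans (proj_norm _ _)).
Qed.

(** [r] is the discrepancy between [Psi] and [e] on the limit and c_0 functionals. On [approx f n K]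
    the formula with [e_ n] is exact. Partial sums with [K] beyond any [K0] allow a head of fixed
    length to be split off. *)
Lemma bidual_formula : exists e (r : nat -> R),
  [/\ `|e| <= B, proj (lo R everything) e = e, forall k, `|r k| <= 2 * B &
   forall f (d : R) K0, 0 < d -> exists2 K, (K0 <= K)%N &
     `|Psi f - (f e + \sum_(k < K) nu f k * r k)| <= d].
Proof.
have [e [eB pe en]] := e_limit.
exists e, (fun k => Psi (ev (ltot R k)) - e (ltot R k)); split => //.
  move=> k; rewrite (le_trans (ler_normB _ _))// mulr_natl mulr2n lerD//.
    by rewrite (le_trans (PsiB _))// ler_piMr// ev_norm.
  by rewrite (le_trans (tspace_norm _ _)).
move=> f d K0 d0; set C := B + 2 * `|f| + 1.
have C0 : 0 < C by rewrite ltr_wpDl// addr_ge0// mulr_ge0.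
have dC0 : 0 < d / C by rewrite divr_gt0.
have [N dN] := en _ dC0.
have [n [K [Nn KK fa]]] := approx_dual f N K0 dC0.
exists K => //; have {}dN := dN n Nn.
have PE : Psi (approx f n K) =
    f (e_ n) + \sum_(k < K) nu f k * (Psi (ev (ltot R k)) - e_ n (ltot R k)).
  rewrite /approx linearD linear_sum /= f_e_; congr (_ + _).
  by apply: eq_bigr => k _; rewrite linearZ linearB /= -[in RHS]evE f_e_.
have -> : Psi f - (f e + \sum_(k < K) nu f k * (Psi (ev (ltot R k)) - e (ltot R k))) =
    Psi (f - approx f n K) - f (e - e_ n)
    + \sum_(k < K) nu f k * (e - e_ n) (ltot R k).
  rewrite linearB PE [f (e - _)]linearB /=.
  have -> : \sum_(k < K) nu f k * (e - e_ n) (ltot R k) =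
     \sum_(k < K) nu f k * (Psi (ev (ltot R k)) - e_ n (ltot R k))
     - \sum_(k < K) nu f k * (Psi (ev (ltot R k)) - e (ltot R k)).
    rewrite -sumrB; apply: eq_bigr => k _; rewrite tfunB; ring.
  ring.
have h1 : `|Psi (f - approx f n K)| <= B * (d / C).
  by rewrite (le_trans (PsiB _))// ler_wpM2l.
have h2 : `|f (e - e_ n)| <= `|f| * (d / C).
  by rewrite (le_trans (ler_dual_norm _ _))// ler_wpM2l.
have h3 : `|\sum_(k < K) nu f k * (e - e_ n) (ltot R k)| <= `|f| * (d / C).
  rewrite (le_trans (ler_norm_sum _ _ _))//.
  apply: (@le_trans _ _ (\sum_(k < K) `|nu f k| * (d / C))).
    apply: ler_sum => k _; rewrite normrM ler_wpM2l//.
    by rewrite (le_trans (tspace_norm _ _)).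
  by rewrite -mulr_suml ler_wpM2r ?sum_nu_le// ltW.
rewrite (le_trans (ler_normD _ _))//.
have := ler_normB (Psi (f - approx f n K)) (f (e - e_ n)).
have dE : d = C * (d / C) by rewrite mulrC divfK// gt_eqF.
set q := d / C in h1 h2 h3 dC0 dE *; move: dE; rewrite /C => dE; lra.
Qed.

End Psi.
End WeakStarLimit.

(** * The subspace Y and its upper 2-estimate *)

Section FiniteFunctionals.
Variable R : realType.
Implicit Types (x h : tspace R) (phi psi : test R) (f : dual_space (tspace R)).

Definition finitely_supported : {pred dual_space (tspace R)} :=
  [pred f | `[< exists n, fproj (lo R (before n)) f = f >]].

Lemma fproj_widen n m f : (n <= m)%N ->
  fproj (lo R (before n)) f = f -> fproj (lo R (before m)) f = f.
Proof.
move=> nm E; rewrite -[in RHS]E -[in LHS]E; apply: dual_ext => x; rewrite !fprojE.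
rewrite (proj_comp (b := lo R (before n)))// => t _ /=.
by case: (ltnP t n) => // tn; rewrite (leq_trans tn).
Qed.

Lemma finitely_supported_submod : submod_closed finitely_supported.
Proof.
split=> [|a f g /asboolP[n fn] /asboolP[m gm]]; apply/asboolP.
  by exists 0%N; apply: dual_ext.
exists (maxn n m).
have {}fn := fproj_widen (leq_maxl n m) fn.
have {}gm := fproj_widen (leq_maxr n m) gm.
apply: dual_ext => x; rewrite fprojE !dualD !dual_scale.
by rewrite -[in RHS]fn -[in RHS]gm !fprojE.
Qed.

HB.instance Definition _ := GRing.isSubmodClosed.Build R (dual_space (tspace R))
  finitely_supported finitely_supported_submod.

(** Since initial projections have finite rank, this is the span of the jump coordinates
    [ev (ctest t k)]. *)
Definition fspace := (finitely_supported : submodClosed (dual_space (tspace R))).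

Local Notation Y := (subspace_type fspace).

Implicit Types y : Y.

Lemma fspace_normE y : `|y| = `|subspace_val y|. Proof. by []. Qed.

Lemma fspaceD y z : subspace_val (y + z) = subspace_val y + subspace_val z.
Proof. by []. Qed.

Lemma fspaceB y z : subspace_val (y - z) = subspace_val y - subspace_val z.
Proof. by []. Qed.

Lemma fspaceZ a y : subspace_val (a *: y) = a *: subspace_val y.
Proof. by []. Qed.

Lemma fspace_sum I (r : seq I) (P : pred I) (F : I -> Y) :
  subspace_val (\sum_(i <- r | P i) F i) = \sum_(i <- r | P i) subspace_val (F i).
Proof. by elim/big_rec2: _ => // i y z _ <-. Qed.

Lemma fspaceP y : exists n, fproj (lo R (before n)) (subspace_val y) = subspace_val y.
Proof. by have /asboolP := subspace_valP y. Qed.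

Lemma fproj_lo_idem n f :
  fproj (lo R (before n)) (fproj (lo R (before n)) f) = fproj (lo R (before n)) f.
Proof.
apply: dual_ext => x; rewrite !fprojE (proj_comp (b := lo R (before n)))// => t _.
by rewrite andbb.
Qed.

Lemma ylo_subproof n y : fproj (lo R (before n)) (subspace_val y) \in fspace.
Proof. by apply/asboolP; exists n; rewrite fproj_lo_idem. Qed.

Definition ylo n y : Y := SubspaceType (ylo_subproof n y).

Lemma yunit_subproof t k : ev (ctest R t k) \in fspace.
Proof.
apply/asboolP; exists t.+1; apply: dual_ext => x; rewrite fprojE !evE projE.
congr (x _); apply: test_ext => s j; rewrite mtestE ctestE /=.
case: ifPn => //; rewrite negb_and; case: (ltnP 0 s) => //= s0.
by rewrite -leqNgt => /gtn_eqF ->.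
Qed.

Definition yunit t k : Y := SubspaceType (yunit_subproof t k).

Lemma ylo_sum n y : ylo n y =
  \sum_(p : 'I_n * 'I_n) subspace_val y (dvec R p.1 p.2) *: yunit p.1 p.2.
Proof. by apply: val_inj; rewrite /= fproj_lo_sum fspace_sum. Qed.

Lemma fproj_hi_ylo n y :
  fproj (hi R (before n)) (subspace_val y) = subspace_val (y - ylo n y).
Proof.
have [m ym] := fspaceP y; rewrite fspaceB /=; apply: dual_ext => x.
have com (b : tmask R) : fproj b (subspace_val y) x =
    subspace_val y (proj b (proj (lo R (before m)) x)).
  rewrite fprojE -[in LHS]ym fprojE; congr (dual_fun _ _).
  apply/val_inj/funext => phi; rewrite /=; congr (x _); apply: test_ext => t k.
  by rewrite !mtestE; case: (0 < t)%N => //=; case: (b t); case: (t < m)%N.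
have idem : proj (lo R (before m)) (proj (lo R (before m)) x) = proj (lo R (before m)) x.
  by rewrite (proj_comp (b := lo R (before m)))// => t _; rewrite andbb.
rewrite dualB !com (proj_hi_lo _ idem) linearB /=; congr (_ - _).
by rewrite -[in RHS]ym fprojE.
Qed.

(** Dual to the lower 2-estimate of X, by Cauchy-Schwarz. *)
Lemma dual_lo_hi_sqr (m : cut) f g : fproj (lo R m) f = f -> fproj (hi R m) g = g ->
  `|f + g| ^+ 2 <= `|f| ^+ 2 + `|g| ^+ 2.
Proof.
move=> fm gm; set S := `|f| ^+ 2 + _.
have S0 : 0 <= S by rewrite addr_ge0 ?sqr_ge0.
rewrite -(sqr_sqrtr S0) ler_sqr ?nnegrE ?sqrtr_ge0//.
apply: dual_space_norm_le => [|x]; first exact: sqrtr_ge0.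
rewrite dualD -fm -gm !fprojE (le_trans (ler_normD _ _))//.
have := lo_hi_sqr m x; have := ler_dual_norm f (proj (lo R m) x).
have := ler_dual_norm g (proj (hi R m) x).
set a := `|proj _ x|; set b := `|proj _ x| => gb fa ab.
apply: (le_trans (lerD fa gb)).
have fg0 : 0 <= `|f| * a + `|g| * b by rewrite addr_ge0// mulr_ge0// normr_ge0.
rewrite -ler_sqr ?nnegrE ?mulr_ge0 ?sqrtr_ge0//.
rewrite exprMn sqr_sqrtr// (le_trans _ (ler_wpM2l S0 ab))// /S.
have := sqr_ge0 (`|f| * b - `|g| * a).
set F := `|f|; set G := `|g|; nra.
Qed.

End FiniteFunctionals.

(** * Uniformly small tails of absolutely bounded series of functionals on Y *)

Section AbsolutelyBoundedSeries.
Variable R : realType.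
Local Notation Y := (subspace_type (@fspace R)).
Variables (g : nat -> {linear Y -> R}) (C : R).
Hypothesis gC : forall K (y : Y), \sum_(0 <= k < K) `|g k y| <= C * `|y|.

Let g_lin k z t z' : g k (z + t *: z') = g k z + t * g k z'.
Proof. by rewrite linearD [g k (_ *: _)]linearZ. Qed.

Lemma series_mono N N' K K' (y : Y) : (N <= N')%N -> (N' <= K')%N -> (K' <= K)%N ->
  \sum_(N' <= k < K') `|g k y| <= \sum_(N <= k < K) `|g k y|.
Proof.
move=> NN NK KK; rewrite (big_cat_nat NN (leq_trans NK KK)) /=.
rewrite (big_cat_nat NK KK) /= addrCA lerDl addr_ge0//; exact: sumr_ge0.
Qed.

(** [ylo n y] lies in the span of finitely many fixed vectors, with coefficients at most [|y|]; only
    the sums on these vectors have to be small. *)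
Lemma series_tail_basis n (d : R) : 0 < d ->
  exists N, forall L (y : Y), (N <= L)%N -> \sum_(N <= k < L) `|g k (ylo n y)| <= d * `|y|.
Proof.
move=> d0.
pose s k := \sum_(p : 'I_n * 'I_n) `|g k (yunit R p.1 p.2)|.
pose v L := \sum_(0 <= k < L) s k.
have s0 k : 0 <= s k by exact: sumr_ge0.
have vnd : nondecreasing_seq v.
  by apply/nondecreasing_seqP => L; rewrite /v big_nat_recr //= lerDl.
have vB L : v L <= \sum_(p : 'I_n * 'I_n) C * `|yunit R p.1 p.2|.
  by rewrite /v exchange_big /=; apply: ler_sum => p _; exact: gC.
have [N HN] := nondecreasing_bounded_flat vnd vB d0.
exists N => L y NL; apply: (@le_trans _ _ (\sum_(N <= k < L) s k * `|y|)).
  apply: ler_sum => k _; rewrite ylo_sum linear_sum (le_trans (ler_norm_sum _ _ _))//.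
  rewrite mulr_suml; apply: ler_sum => p _; rewrite linearZ /= normrM mulrC.
  rewrite ler_wpM2l// (le_trans (ler_dual_norm _ _))// ler_piMr//; exact: dvec_le1.
rewrite -mulr_suml ler_wpM2r// (le_trans _ (HN _ NL))//.
by rewrite /v (big_cat_nat (leq0n N) NL) /= addrAC subrr add0r.
Qed.

Lemma signed_sum_le (w z : Y) N K :
  \sum_(N <= k < K) Num.sg (g k w) * g k z <= \sum_(N <= k < K) `|g k z|.
Proof.
apply: ler_sum => k _; rewrite (le_trans (ler_norm _))// normrM normr_sg.
by rewrite ler_piMl//; case: (_ != 0).
Qed.

(* Otherwise take [y1] and then [y2] far away, both of norm 1 and with sums above
   [3/4 * eta]; for one choice of the sign [t] the cross terms are nonnegative,
   whereas [y1 + t *: y2] has norm at most [sqrt 2 < 149/100]. *)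
Lemma series_tail_contract (eta : R) N : 0 < eta ->
  (forall K (y : Y), (N <= K)%N -> \sum_(N <= k < K) `|g k y| <= eta * `|y|) ->
  exists N', forall K (y : Y), (N' <= K)%N ->
    \sum_(N' <= k < K) `|g k y| <= 3/4 * eta * `|y|.
Proof.
move=> eta0 HN; apply: contrapT => /forallNP nH.
have wit M : exists K (y : Y), [/\ (M <= K)%N, `|y| = 1 &
    3/4 * eta < \sum_(M <= k < K) `|g k y|].
  have /existsNP[K /existsNP[y /not_implyP[MK /negP]]] := nH M.
  rewrite -ltNge => yl; exists K.
  have y0 : y != 0.
    apply: contraTneq yl => ->; rewrite normr0 mulr0 -leNgt big1// => k _.
    by rewrite linear0 normr0.
  have ny0 : 0 < `|y| by rewrite normr_gt0.
  exists (`|y|^-1 *: y); split => //; first by rewrite normfZV.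
  rewrite (eq_bigr (fun k => `|y|^-1 * `|g k y|)); last first.
    by move=> k _; rewrite linearZ /= normrM normfV normr_id.
  by rewrite -mulr_sumr ltr_pdivlMl// mulrC.
have [K1 [y1 [NK1 ny1 gy1]]] := wit N.
have [n1 yn1] := fspaceP y1.
(* Removing the start of [y2] costs 1/100, leaving 3/4 - 1/100 = 37/50; then 3/4 + 37/50 = 149/100
   still exceeds sqrt 2. *)
have e0 : 0 < eta / 100 by rewrite divr_gt0.
have [M HM] := series_tail_basis n1 e0.
have [K2 [y2 [MK2 ny2 gy2]]] := wit (maxn M K1).
set N2 := maxn M K1 in MK2 gy2.
have NN2 : (N <= N2)%N by rewrite (leq_trans NK1)// leq_maxr.
have MN2 : (M <= N2)%N by exact: leq_maxl.
(* The tail of [y2] starts where [y1] ends, as the upper 2-estimate requires. *)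
pose w := y2 - ylo n1 y2.
have wE := fproj_hi_ylo n1 y2.
have nw : `|w| <= 1 by rewrite -ny2 !fspace_normE -wE fproj_norm.
have gw : 37/50 * eta <= \sum_(N2 <= k < K2) `|g k w|.
  have h1 : \sum_(N2 <= k < K2) `|g k (ylo n1 y2)| <= eta / 100.
    have := HM K2 y2 (leq_trans MN2 MK2); rewrite ny2 mulr1; apply: le_trans.
    exact: series_mono.
  have h2 : \sum_(N2 <= k < K2) `|g k y2| <=
      \sum_(N2 <= k < K2) `|g k w| + \sum_(N2 <= k < K2) `|g k (ylo n1 y2)|.
    rewrite -big_split; apply: ler_sum => k _ /=.
    by rewrite -{1}(subrK (ylo n1 y2) y2) linearD ler_normD.
  lra.
pose G1 z := \sum_(N <= k < K1) Num.sg (g k y1) * g k z.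
pose G2 z := \sum_(N2 <= k < K2) Num.sg (g k w) * g k z.
have G1D z z' (t : R) : G1 (z + t *: z') = G1 z + t * G1 z'.
  rewrite /G1 mulr_sumr -big_split; apply: eq_bigr => k _.
  by rewrite g_lin mulrDr mulrCA.
have G2D z z' (t : R) : G2 (z + t *: z') = G2 z + t * G2 z'.
  rewrite /G2 mulr_sumr -big_split; apply: eq_bigr => k _.
  by rewrite g_lin mulrDr mulrCA.
have G1y : 3/4 * eta < G1 y1.
  by rewrite /G1 (eq_bigr (fun k => `|g k y1|))// => k _; rewrite -normrEsg.
have G2w : 37/50 * eta <= G2 w.
  by rewrite /G2 (eq_bigr (fun k => `|g k w|))// => k _; rewrite -normrEsg.
have Gle (t : R) z : `|t| = 1 -> G1 z + t * G2 z <= eta * `|z|.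
  move=> t1; apply: (le_trans _ (HN K2 z (leq_trans NN2 MK2))).
  have K1N2 : (K1 <= N2)%N by exact: leq_maxr.
  rewrite (big_cat_nat NK1 (leq_trans K1N2 MK2)) /= lerD//.
    exact: signed_sum_le.
  apply: (@le_trans _ _ (\sum_(N2 <= k < K2) `|g k z|)); last exact: series_mono.
  rewrite /G2 mulr_sumr; apply: ler_sum => k _.
  rewrite (le_trans (ler_norm _))// !normrM normr_sg t1 mul1r.
  by rewrite ler_piMl//; case: (_ != 0).
have nz (t : R) : `|t| = 1 -> `|y1 + t *: w| ^+ 2 <= 2.
  move=> t1; rewrite fspace_normE fspaceD fspaceZ.
  apply: (le_trans (dual_lo_hi_sqr yn1 _)).
    rewrite -wE; apply: dual_ext => x; rewrite fprojE !dual_scale !fprojE.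
    by rewrite (proj_comp (b := hi R (before n1)))// => s _; rewrite andbb.
  rewrite normrZ t1 mul1r -!fspace_normE ny1 expr1n (_ : 2 = 1 + 1)// lerD2l.
  by rewrite expr_le1.
have contra (t : R) : `|t| = 1 -> t * t = 1 -> 0 <= t * (G2 y1 + G1 w) -> False.
  move=> t1 tt cross.
  have := Gle t (y1 + t *: w) t1; rewrite G1D G2D mulrDr mulrA tt mul1r.
  have := nz t t1; set Z := `|_ + _|.
  have Z0 : 0 <= Z by exact: normr_ge0.
  move=> Z2 ZG; have Z149 : Z < 149/100 by rewrite ltNge; apply/negP => ?; nra.
  have : eta * Z < eta * (149/100) by rewrite ltr_pM2l.
  rewrite mulrDr in cross; lra.
have [c0|c0] := leP 0 (G2 y1 + G1 w).
  by apply: (contra 1); rewrite ?normr1 ?mul1r.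
by apply: (contra (-1)); rewrite ?normrN1 ?mulrNN ?mul1r// mulN1r oppr_ge0 ltW.
Qed.

Lemma series_tail_small (e : R) : 0 < e ->
  exists N, forall K (y : Y), (N <= K)%N -> \sum_(N <= k < K) `|g k y| <= e * `|y|.
Proof.
(* The contraction step needs a positive constant to start from. *)
move=> e0; set C1 := `|C| + 1; have C10 : 0 < C1 by rewrite ltr_wpDl.
have iter j : exists N, forall K (y : Y), (N <= K)%N ->
    \sum_(N <= k < K) `|g k y| <= (3/4) ^+ j * C1 * `|y|.
  elim: j => [|j [N HN]].
    exists 0%N => K y _; rewrite expr0 mul1r (le_trans (gC _ _))// ler_wpM2r//.
    by rewrite (le_trans (ler_norm C))// lerDl.
  have [|N' HN'] := series_tail_contract _ HN.
    by rewrite mulr_gt0// exprn_gt0.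
  by exists N' => K y NK; rewrite exprS; have := HN' K y NK; rewrite !mulrA.
have : (fun j => (3/4) ^+ j * C1) @ \oo --> (0 : R).
  rewrite -[X in _ --> X](mul0r C1); apply: cvgMr_tmp.
  by apply: cvg_expr; rewrite ger0_norm; lra.
move=> /cvgr_le /(_ _ e0) [j _ /(_ j (leqnn j)) /= je].
have [N HN] := iter j; exists N => K y NK.
by rewrite (le_trans (HN _ _ NK))// ler_wpM2r.
Qed.

End AbsolutelyBoundedSeries.

(** * An embedding of Y has a range that is not total *)

Section NonInjective.
Variable R : realType.
Local Notation X := (tspace R).
Local Notation Y := (subspace_type (@fspace R)).
Implicit Types (x : X) (y : Y) (f : dual_space X).

Lemma nontrivial_left_kernel (F : fieldType) n (A : 'M[F]_(n.+1, n)) :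
  exists2 v : 'rV_n.+1, v != 0 & v *m A = 0.
Proof.
have : kermx A != 0.
  by rewrite -mxrank_eq0 mxrank_ker subn_eq0 -ltnNge ltnS rank_leq_col.
by move=> /rowV0Pn[v /sub_kermxP vA v0]; exists v.
Qed.

Definition nuf k f := nu f k.

Lemma nu_linear k : linear (nuf k).
Proof.
move=> a f g; apply: cvg_lim => //.
by apply: cvgD; [apply: cvgMl_tmp; exact: nuP|exact: nuP].
Qed.

HB.instance Definition _ k :=
  GRing.isLinear.Build R (dual_space X) R *:%R (nuf k) (@nu_linear k).

Lemma zpart_norm N (r : nat -> R) (b : R) : 0 <= b -> (forall k, `|r k| <= b) ->
  `|\sum_(k < N) r k *: dvec R 0 k| <= b.
Proof.
move=> b0 rb; apply: tspace_norm_le => phi; rewrite tfun_sum.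
case: (testP phi) => [[pi [c [kappa [_ _ phiE]]]]|[j phiE]].
  rewrite big1 ?normr0// => k _; rewrite tfunZ dvecE phiE; exact: mulr0.
rewrite (eq_bigr (fun k : 'I_N => if (k == j :> nat) then r k else 0)); last first.
  move=> k _; rewrite tfunZ dvecE phiE /ztest_fun eqxx /=.
  by case: (_ == _); rewrite ?mulr1 ?mulr0.
rewrite -big_mkcond /=; have [jN|jN] := ltnP j N.
  by rewrite (big_pred1 (Ordinal jN)).
by rewrite big_pred0 ?normr0// => k; rewrite ltn_eqF// (leq_trans (ltn_ord k)).
Qed.

Lemma proj_lo_zpart N (r : nat -> R) m :
  proj (lo R m) (\sum_(k < N) r k *: dvec R 0 k) = 0.
Proof.
rewrite linear_sum big1// => k _; rewrite linearZ /=.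
by rewrite (_ : proj _ _ = 0) ?scaler0//; exact: proj_dvec.
Qed.

Lemma proj_lo_ztest m x j : proj (lo R m) x (ztest R j) = 0.
Proof.
rewrite projE tfun_zero// => t k; rewrite mtestE.
by case: t => //= t; rewrite if_same.
Qed.

Lemma zpart_ztest N (r : nat -> R) j :
  (\sum_(k < N) r k *: dvec R 0 k) (ztest R j) = if (j < N)%N then r j else 0.
Proof.
rewrite tfun_sum (eq_bigr (fun k : 'I_N => if (k == j :> nat) then r k else 0)); last first.
  by move=> k _; rewrite tfunZ dvecE /= /ztest_fun eqxx /=; case: (_ == _); rewrite ?mulr1 ?mulr0.
rewrite -big_mkcond /=; case: ifPn => jN; first by rewrite (big_pred1 (Ordinal jN)).
rewrite big_pred0// => k; rewrite ltn_eqF// (leq_trans (ltn_ord k))//.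
by rewrite leqNgt.
Qed.

Variables (T : {linear Y -> dual_space X}) (C B : R).
Hypotheses (TC : forall y, `|T y| <= C * `|y|) (B0 : 0 < B)
  (TB : forall y, `|y| <= B * `|T y|).

Let gT k : {linear Y -> R} := nuf k \o T.

Let gTC K y : \sum_(0 <= k < K) `|gT k y| <= C * `|y|.
Proof. by rewrite big_mkord (le_trans (sum_nu_le _ _)). Qed.

Let C0 y : 0 <= C * `|y|.
Proof. exact: le_trans (TC y). Qed.

(** With coefficients at most [2 * (B * b)], a tail bounded by 1 / (8 B) leaves an error of [b / 4],
    within the [b / 2] aimed at. *)
Let tail_index := series_tail_small gTC (divr_gt0 ltr01 (mulr_gt0 (ltr0Sn R 7) B0)).
Let N := sval (cid tail_index).

Let tail_le K y : (N <= K)%N ->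
  \sum_(N <= k < K) `|nu (T y) k| <= 1 / (8 * B) * `|y|.
Proof. exact: (svalP (cid tail_index)). Qed.

(* The first [N] coordinates in c_0 of [x] serve as coefficients of the finitely
   many functionals [y |-> nu (T y) k]. *)
Let L x y : R := T y (proj (lo R everything) x) + \sum_(k < N) x (ztest R k) * nu (T y) k.

Let L_lin a x x' y : L (a *: x + x') y = a * L x y + L x' y.
Proof.
rewrite /L linearP linearP /= mulrDr mulr_sumr addrACA; congr (_ + _).
rewrite -big_split; apply: eq_bigr => k _ /=.
by rewrite -[X in X * _]/(a * x (ztest R k) + x' (ztest R k)) mulrDl mulrA.
Qed.

Let L_y_linear x : linear (L x).
Proof.
move=> a y z; rewrite /L linearP.
rewrite -[X in X + _]/(a * T y (proj (lo R everything) x) + T z (proj (lo R everything) x)).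
rewrite (_ : \sum_(k < N) _ = a * (\sum_(k < N) x (ztest R k) * nu (T y) k)
   + \sum_(k < N) x (ztest R k) * nu (T z) k); last first.
  rewrite mulr_sumr -big_split; apply: eq_bigr => k _ /=.
  rewrite (_ : nu (a *: T y + T z) k = a * nu (T y) k + nu (T z) k).
    by rewrite mulrDr mulrCA.
  exact: nu_linear.
by rewrite addrACA -mulrDr.
Qed.

Let L_bound x y : `|L x y| <= 2 * C * `|y| * `|x|.
Proof.
have h1 : `|T y (proj (lo R everything) x)| <= C * `|y| * `|x|.
  rewrite (le_trans (ler_dual_norm _ _))//.
  by apply: ler_pM => //; exact: proj_norm.
have h2 : `|\sum_(k < N) x (ztest R k) * nu (T y) k| <= C * `|y| * `|x|.
  rewrite (le_trans (ler_norm_sum _ _ _))//.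
  apply: (@le_trans _ _ (\sum_(k < N) `|nu (T y) k| * `|x|)).
    by apply: ler_sum => k _; rewrite normrM mulrC ler_wpM2l// tspace_norm.
  by rewrite -mulr_suml ler_wpM2r// (le_trans (sum_nu_le _ _)).
by rewrite /L (le_trans (ler_normD _ _))//; lra.
Qed.

(** [g] is carried to the range of [T] with norm at most [B * b] and extended to [Psi]. [L]
    reproduces the component [e] of [Psi] and the first [N] terms of the sum; the tail is the
    error. *)
Let half_approx (g : Y -> R) (b : R) : linear g -> 0 <= b ->
  (forall y, `|g y| <= b * `|y|) ->
  exists2 x, `|x| <= 3 * (B * b) & forall y, `|g y - L x y| <= b / 2 * `|y|.
Proof.
move=> gl b0 gb.
pose G : {linear Y -> R} := HB.pack g (GRing.isLinear.Build R Y R *:%R g gl).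
have Bb0 : 0 <= B * b by rewrite mulr_ge0// ltW.
have GB y : `|G y| <= B * b * `|T y|.
  by rewrite (le_trans (gb y))// [B * b]mulrC -mulrA ler_wpM2l.
have [q [ql qB qT]] := hahn_banach Bb0 GB.
pose Psi : {linear dual_space X -> R} := HB.pack q
  (GRing.isLinear.Build R (dual_space X) R *:%R q ql).
have [e [r [eB pe rB form]]] := @bidual_formula R Psi _ Bb0 qB.
(* The coordinates of [x] in c_0 store the coefficients that [L] reads; [3 = 1 + 2] adds the bounds
   on [e] and on [r]. *)
pose z := \sum_(k < N) r k *: dvec R 0 k.
exists (e + z).
  rewrite (le_trans (ler_normD _ _))// (_ : 3 * (B * b) = B * b + 2 * (B * b)); last by ring.
  by rewrite lerD// zpart_norm// mulr_ge0.
move=> y.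
have Lz : L (e + z) y = T y e + \sum_(k < N) nu (T y) k * r k.
  have pz : proj (lo R everything) (e + z) = e.
    by rewrite linearD /= proj_lo_zpart addr0 pe.
  rewrite /L pz; congr (_ + _).
  apply: eq_bigr => k _; rewrite tfunD -[in e _]pe proj_lo_ztest add0r.
  by rewrite zpart_ztest ltn_ord mulrC.
apply/ler_addgt0Pl => d d0.
have [K NK Kd] := form (T y) d N d0.
have -> : g y - L (e + z) y =
    (Psi (T y) - (T y e + \sum_(k < K) nu (T y) k * r k))
    + \sum_(N <= k < K) nu (T y) k * r k.
  rewrite Lz -[Psi (T y)]/(q (T y)) qT.
  rewrite -(big_mkord xpredT (fun k => nu (T y) k * r k)).
  rewrite -(big_mkord xpredT (fun k => nu (T y) k * r k)).
  rewrite [in RHS](big_cat_nat (leq0n N) NK) /=; ring.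
rewrite (le_trans (ler_normD _ _))// lerD//.
rewrite (le_trans (ler_norm_sum _ _ _))//.
apply: (@le_trans _ _ (\sum_(N <= k < K) `|nu (T y) k| * (2 * (B * b)))).
  by apply: ler_sum => k _; rewrite normrM ler_wpM2l.
rewrite -mulr_suml.
apply: (@le_trans _ _ (1 / (8 * B) * `|y| * (2 * (B * b)))).
  by apply: ler_wpM2r; [rewrite mulr_ge0|exact: tail_le].
have -> : 1 / (8 * B) * `|y| * (2 * (B * b)) = b / 4 * `|y|.
  by field; rewrite gt_eqF.
by have := mulr_ge0 b0 (normr_ge0 y); lra.
Qed.

Let improve (g : Y -> R) x (b : R) : linear g -> 0 <= b ->
  (forall y, `|g y - L x y| <= b * `|y|) ->
  exists x', `|x' - x| <= 3 * (B * b) /\ forall y, `|g y - L x' y| <= b / 2 * `|y|.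
Proof.
move=> gl b0 gb.
have hl : linear (fun y => g y - L x y).
  move=> a y z; rewrite gl L_y_linear.
  rewrite -[LHS]/(a * g y + g z - (a * L x y + L x z)).
  rewrite -[RHS]/(a * (g y - L x y) + (g z - L x z)); ring.
have [x1 x1b x1g] := half_approx hl b0 gb.
exists (x + x1); rewrite addrAC subrr add0r; split => // y.
have := L_lin 1 x x1 y; rewrite scale1r mul1r => ->.
by rewrite opprD addrA.
Qed.

(** Each correction halves the error and has norm proportional to it, so the corrections sum up in
    the complete space X. *)
Let L_onto (g : Y -> R) (b : R) : linear g -> 0 <= b ->
  (forall y, `|g y| <= b * `|y|) -> exists x, forall y, g y = L x y.
Proof.
move=> gl b0 gb.
pose bj j : R := b / 2 ^+ j.
have bj0 j : 0 <= bj j by rewrite divr_ge0// exprn_ge0.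
have bjS j : bj j / 2 = bj j.+1 by rewrite /bj exprSr invfM mulrA.
pose good j x := forall y, `|g y - L x y| <= bj j * `|y|.
have next jx : exists x', good jx.1 jx.2 ->
    `|x' - jx.2| <= 3 * (B * bj jx.1) /\ good jx.1.+1 x'.
  have [gx|ngx] := pselect (good jx.1 jx.2); last by exists 0 => /ngx.
  have [x' [h1 h2]] := improve gl (bj0 jx.1) gx.
  by exists x' => _; split => // y; rewrite -bjS.
have [F FP] := choice next.
pose xs := fix xs j := if j is i.+1 then F (i, xs i) else 0.
have xs_good j : good j (xs j).
  elim: j => [y|j IH]; last by have [] := FP (j, xs j) IH.
  rewrite /bj expr0 divr1 (_ : L _ _ = 0) ?subr0//=.
  have := L_lin 0 0 0 y; rewrite scaler0 addr0 mul0r add0r => E.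
  by have := L_lin 1 0 0 y; rewrite scale1r addr0; lra.
have xs_step j : `|xs j.+1 - xs j| <= 3 * (B * bj j).
  by have [] := FP (j, xs j) (xs_good j).
(* 6 = 3 (1 + 1/2 + 1/4 + ...); the term on the left is the length still to be travelled, and makes
   the induction close. *)
have xs_far j k : `|xs (j + k)%N - xs j| + 6 * (B * bj (j + k)%N) <= 6 * (B * bj j).
  elim: k => [|k IH]; first by rewrite addn0 subrr normr0 add0r.
  rewrite addnS; apply: le_trans IH.
  have := xs_step (j + k)%N; rewrite -bjS.
  have := ler_normD (xs (j + k).+1 - xs (j + k)%N) (xs (j + k)%N - xs j).
  by rewrite addrA subrK; lra.
have bj_small (d : R) : 0 < d -> exists j, 6 * (B * bj j) < d.
  move=> d0; have : (fun j => (6 * B * b) * (2^-1) ^+ j) @ \oo --> (0 : R).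
    by apply: (@cvg_geometric R (6 * B * b)); rewrite ger0_norm; lra.
  move=> /cvgr_lt /(_ _ d0) [j _ /(_ j (leqnn j)) /= jd]; exists j.
  by move: jd; rewrite /bj exprVn !mulrA.
have far_le (d : R) : 0 < d -> exists j, forall i, (j <= i)%N -> `|xs i - xs j| < d.
  move=> d0; have [j jd] := bj_small _ d0; exists j => i ji.
  have := xs_far j (i - j)%N; rewrite subnKC//.
  have : 0 <= B * bj i by rewrite mulr_ge0// ltW.
  lra.
have cxs : cvg (xs @ \oo).
  apply: cauchy_cvg; apply: cauchy_exP => d d0.
  have [j jd] := far_le _ d0; exists (xs j), j => // i /= ji.
  by rewrite -ball_normE /ball_ /= distrC jd.
exists (lim (xs @ \oo)) => y; set x := lim _.
apply/eqP; rewrite -subr_eq0 -normr_le0; apply/ler_addgt0Pl => d d0; rewrite addr0.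
have C'0 : 0 < 2 * (C * `|y|) + 1 by have := C0 y; lra.
have d20 : 0 < d / 2 by rewrite divr_gt0.
have dC0 : 0 < d / 2 / (2 * (C * `|y|) + 1) by exact: divr_gt0.
have n1 : \forall j \near \oo, bj j * `|y| <= d / 2.
  have : (fun j => (b * `|y|) * (2^-1) ^+ j) @ \oo --> (0 : R).
    by apply: (@cvg_geometric R (b * `|y|)); rewrite ger0_norm; lra.
  by move=> /cvgr_le /(_ _ d20); apply: filterS => j; rewrite /bj exprVn mulrAC.
have n2 : \forall j \near \oo, `|x - xs j| <= d / 2 / (2 * (C * `|y|) + 1).
  by have /cvgrPdist_le := cxs; exact.
have [j [h1 h2]] := filter_ex (filterI n1 n2).
have -> : g y - L x y = (g y - L (xs j) y) - L (x - xs j) y.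
  have := L_lin (-1) (xs j) x y; rewrite scaleN1r [- _ + x]addrC => ->; ring.
rewrite (le_trans (ler_normB _ _))// [leRHS]splitr lerD//.
  by rewrite (le_trans (xs_good j y)).
rewrite (le_trans (L_bound _ _))//.
apply: (@le_trans _ _ (2 * C * `|y| * (d / 2 / (2 * (C * `|y|) + 1)))).
  by rewrite ler_wpM2l//; have := C0 y; lra.
have dE : d / 2 = (2 * (C * `|y|) + 1) * (d / 2 / (2 * (C * `|y|) + 1)).
  by rewrite [RHS]mulrC divfK// gt_eqF.
rewrite [leRHS]dE ler_wpM2r//; [exact: ltW|lra].
Qed.

Let z_functional y i : `|T y (dvec R 0 i)| <= `|C| * `|y|.
Proof.
rewrite (le_trans (ler_dual_norm _ _))//.
apply: (@le_trans _ _ (`|T y|)); first by rewrite ler_piMr// dvec_le1.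
by rewrite (le_trans (TC y))// ler_wpM2r// ler_norm.
Qed.

(** Up to elements of E, each unit vector of c_0 acts on the range of [T] as a combination of the
    same [N] functionals. So [N + 1] of them have a nontrivial combination that acts as an element
    of E; its coordinates in c_0 are not affected by subtracting that element. *)
Lemma embedding_not_total : exists2 x, x != 0 & forall y, T y x = 0.
Proof.
have sol i : exists x, forall y, T y (dvec R 0 i) = L x y.
  apply: (@L_onto (fun y => T y (dvec R 0 i)) `|C|) => //.
  by move=> a y z; rewrite linearP.
have [s sP] := choice sol.
have [v v0 vA] := @nontrivial_left_kernel R N (\matrix_(i, k) s i (ztest R k)).
pose x := \sum_(i < N.+1) v 0 i *: (dvec R 0 i - proj (lo R everything) (s i)).
exists x.
  apply: contraNneq v0 => x0; apply/eqP/rowP => i; rewrite !mxE.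
  have : x (ztest R i) = 0 by rewrite x0.
  rewrite /x tfun_sum (bigD1 i)//= big1 ?addr0.
    move=> <-.
    rewrite -[RHS]/(v 0 i * (dvec R 0 i (ztest R i)
                             - proj (lo R everything) (s i) (ztest R i))).
    by rewrite proj_lo_ztest subr0 dvecE /= /ztest_fun !eqxx mulr1.
  move=> j ji.
  rewrite -[LHS]/(v 0 j * (dvec R 0 j (ztest R i) - proj (lo R everything) (s j) (ztest R i))).
  rewrite proj_lo_ztest subr0 dvecE /= /ztest_fun /= (_ : (j == i :> nat) = false) ?mulr0//.
  exact/negbTE.
move=> y; rewrite /x linear_sum.
have E i : T y (v 0 i *: (dvec R 0 i - proj (lo R everything) (s i))) =
    v 0 i * \sum_(k < N) s i (ztest R k) * nu (T y) k.
  by rewrite dualZ linearB /= sP /L addrAC subrr add0r.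
rewrite (eq_bigr (fun i : 'I_N.+1 => \sum_(k < N) v 0 i * (s i (ztest R k) * nu (T y) k))).
  rewrite exchange_big big1// => k _ /=.
  have := congr1 (fun M : 'rV_N => M 0 k) vA; rewrite !mxE => vk.
  transitivity ((\sum_(i < N.+1) v 0 i * s i (ztest R k)) * nu (T y) k).
    by rewrite mulr_suml; apply: eq_bigr => i _; rewrite mulrA.
  rewrite (_ : \sum_(i < N.+1) _ = 0) ?mul0r// -[RHS]vk.
  by apply: eq_bigr => i _; rewrite mxE.
by move=> i _; rewrite [LHS]E mulr_sumr.
Qed.


End NonInjective.

(** * Two-sided bounds for an isomorphic embedding *)

Section Embedding.
Variables (R : realType) (V W : normedModType R) (T : {linear V -> W}).

Lemma isomorphic_embedding_bounds : isomorphic_embedding T ->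
  (exists C, forall v, `|T v| <= C * `|v|) /\
  (exists2 B, 0 < B & forall v, `|v| <= B * `|T v|).
Proof.
move=> [Tc [g Tg gc]]; split.
  have /linear_bounded_continuous/linear_boundedP/pinfty_ex_gt0[C _ TC] := Tc.
  by exists C.
have g0 : g 0 = 0 by rewrite -[in LHS](linear0 T) Tg.
have r0 : range T 0 by exists 0; rewrite ?linear0.
have /subspace_continuousP/(_ 0 r0) := gc.
move=> /cvgrPdist_lt/(_ 1 ltr01)/nbhs_normP[d /= d0 dg].
have small v : `|T v| < d -> `|v| < 1.
  move=> Tvd; have := dg (T v); rewrite /= sub0r normrN => /(_ Tvd) /(_ _).
  by rewrite /from_subspace g0 sub0r normrN Tg; apply; exists v.
(* [v] will be rescaled so that [T v] has norm [d / 2], inside the ball where the inverse is below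
   1. *)
exists (2 / d); first by rewrite divr_gt0.
move=> v; have [->|v0] := eqVneq v 0; first by rewrite linear0 !normr0 mulr0.
have Tv0 : T v != 0.
  by apply: contraNneq v0 => Tv; rewrite -(Tg v) Tv g0.
have nTv0 : 0 < `|T v| by rewrite normr_gt0.
have := small ((d / 2 / `|T v|) *: v).
rewrite linearZ /= !normrZ !ger0_norm ?divr_ge0 ?(ltW d0) ?(ltW nTv0)//.
rewrite divfK ?gt_eqF// ltr_pdivrMr// ltr_pMr// ltr1n => /(_ isT).
rewrite mulrAC ltr_pdivrMr// mul1r => h.
rewrite ltW// mulrAC ltr_pdivlMr//; lra.
Qed.

End Embedding.

(** * Separability from rational combinations *)

Section Separability.
Variables (R : realType) (V : normedModType R) (u : nat -> nat -> V).

Lemma separable_of_combinations :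
  (forall v (d : R), 0 < d -> exists n (a : nat -> nat -> R),
     `|v - \sum_(t < n) \sum_(k < n) a t k *: u t k| <= d) ->
  separable V.
Proof.
move=> dense_u.
pose F (p : nat * seq (seq rat)) : V :=
  \sum_(t < p.1) \sum_(k < p.1) ratr (nth 0 (nth [::] p.2 t) k) *: u t k.
exists (range F).
  apply: (card_le_trans (card_image_le _ _)); exact: countableP.
move=> O [v Ov] oO.
have /nbhs_normP[d /= d0 dO] := open_nbhs_nbhs (conj oO Ov).
have d40 : 0 < d / 4 by rewrite divr_gt0.
have [n [a va]] := dense_u v _ d40.
pose S := \sum_(t < n) \sum_(k < n) `|u t k|.
have S0 : 0 <= S by apply: sumr_ge0 => t _; exact: sumr_ge0.
have e0 : 0 < d / 4 / (S + 1) by rewrite divr_gt0// ltr_wpDl.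
have rat_near (r : R) : exists q : rat, `|r - ratr q| <= d / 4 / (S + 1).
  have [q qr] := @rat_in_itvoo R (r - d / 4 / (S + 1)) (r + d / 4 / (S + 1)) ltac:(lra).
  exists q; rewrite ler_distlC; move: qr; rewrite in_itv /= => /andP[/ltW h1 /ltW h2].
  by apply/andP.
have [q qP] := choice rat_near.
pose s := mkseq (fun t => mkseq (fun k => q (a t k)) n) n.
exists (F (n, s)); split; last by exists (n, s).
apply: dO => /=.
have FE : F (n, s) = \sum_(t < n) \sum_(k < n) ratr (q (a t k)) *: u t k.
  by apply: eq_bigr => t _; apply: eq_bigr => k _; rewrite /= !nth_mkseq.
rewrite -(subrKA (\sum_(t < n) \sum_(k < n) a t k *: u t k)).
apply: (le_lt_trans (ler_normD _ _)).
have h : `|\sum_(t < n) \sum_(k < n) a t k *: u t k - F (n, s)| <= d / 4.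
  rewrite FE -sumrB (le_trans (ler_norm_sum _ _ _))//.
  apply: (@le_trans _ _ (\sum_(t < n) \sum_(k < n) d / 4 / (S + 1) * `|u t k|)).
    apply: ler_sum => t _; rewrite -sumrB (le_trans (ler_norm_sum _ _ _))//.
    by apply: ler_sum => k _; rewrite -scalerBl normrZ ler_wpM2r.
  under eq_bigr do rewrite -mulr_sumr.
  rewrite -mulr_sumr -/S mulrAC ler_pdivrMr ?ltr_wpDl// ler_wpM2l ?(ltW d40)//; lra.
lra.
Qed.

End Separability.

(** * The closed norming subspace of infinite codimension *)

Section NormingSubspace.
Variable R : realType.
Local Notation X := (tspace R).
Local Notation Y := (subspace_type (@fspace R)).
Implicit Types (x : X) (y : Y) (F G : dual_space Y).

Lemma ysum_subproof n k : fproj (lo R (before n)) (ev (ltest R k)) \in @fspace R.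
Proof. by apply/asboolP; exists n; rewrite fproj_lo_idem. Qed.

Definition ysum n k : Y := SubspaceType (ysum_subproof n k).

Lemma ysum_norm n k : `|ysum n k| <= 1.
Proof. by rewrite fspace_normE /= (le_trans (fproj_norm _ _))// ev_norm. Qed.

(** The limit functionals are not in [Y], so they are read through their truncations: under Y^* = E,
    [F (ysum n k)] is coordinate [k] of b just before time [n]. *)
Definition vanishing_sums : {pred dual_space Y} :=
  [pred F : dual_space Y | `[< forall k, F (ysum n k) @[n --> \oo] --> (0 : R) >]].

Lemma vanishing_sums_submod : submod_closed vanishing_sums.
Proof.
split=> [|a F G /asboolP F0 /asboolP G0]; apply/asboolP => k; first exact: cvg_cst.
have aF0 : a * F (ysum n k) @[n --> \oo] --> a * 0 by apply: cvgMl_tmp; exact: F0.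
by have := cvgD aF0 (G0 k); rewrite mulr0 addr0; exact.
Qed.

HB.instance Definition _ := GRing.isSubmodClosed.Build R (dual_space Y)
  vanishing_sums vanishing_sums_submod.

Definition msubspace := (vanishing_sums : submodClosed (dual_space Y)).

Lemma closed_msubspace : closed [set` msubspace].
Proof.
move=> F Fcl; apply/asboolP => k; apply/cvgrPdist_le => d d0.
have d20 : 0 < d / 2 by rewrite divr_gt0.
have [|G [/asboolP GM FG]] := Fcl (ball F (d / 2)).
  exact: nbhsx_ballx.
have /cvgrPdist_le/(_ _ d20) := GM k; apply: filterS => n.
rewrite !sub0r !normrN => Gn; rewrite -(subrK (G (ysum n k)) (F (ysum n k))).
rewrite (le_trans (ler_normD _ _))// [leRHS]splitr lerD// -dualB.
rewrite (le_trans (ler_dual_norm _ _))//.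
move: FG; rewrite -ball_normE /ball_ /= => /ltW FG.
by rewrite -[leRHS]mulr1 ler_pM// ysum_norm.
Qed.

Lemma eval_linear x : linear (fun y => subspace_val y x).
Proof. by move=> a y z; rewrite fspaceD fspaceZ dualD dual_scale. Qed.

Lemma eval_bounded x y : `|subspace_val y x| <= `|x| * `|y|.
Proof. by rewrite mulrC ler_dual_norm. Qed.

Definition eval_at x : dual_space Y := bfun (eval_linear x) (eval_bounded x).

Lemma eval_atE x y : eval_at x y = subspace_val y x. Proof. by []. Qed.

Lemma eval_at_norm x : `|eval_at x| <= `|x|.
Proof. by apply: dual_space_norm_le => // y; exact: eval_bounded. Qed.

Lemma eval_ysum x n k :
  eval_at x (ysum n k) = proj (lo R (before n)) x (ltest R k).
Proof. by []. Qed.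

Lemma lo_ltest_ge n x k : proj (lo R (before n)) x = x -> (n <= k)%N -> x (ltest R k) = 0.
Proof.
move=> <- nk; rewrite projE tfun_zero// => t j; rewrite mtestE /=.
case: ifP => // /andP[_ tn]; case: eqP => [->|]; last by rewrite andbF.
by rewrite ltnNge (leq_trans (ltnW tn)).
Qed.

Lemma norming_msubspace : norming [set` msubspace].
Proof.
(* One factor 1/2 for a vector [x] that almost attains the norm of [y], another for the norm 2 of
   its correction [w]. *)
exists (1/4); first by rewrite divr_gt0.
move=> y; set S := [set _ | _ in _].
have S0 s : S s -> 0 <= s by move=> [F _ <-].
have Sub : has_ubound S.
  by exists `|y| => _ [F [_ /= F1] <-]; rewrite (le_trans (ler_dual_norm _ _))// F1 mul1r.
have [y0|y0] := eqVneq y 0.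
  rewrite y0 normr0 mulr0; have [[s Ss]|nS] := pselect (exists s, S s).
    by rewrite (le_trans (S0 _ Ss))// ub_le_sup.
  by rewrite (_ : S = set0) ?sup0//; apply/seteqP; split => // s Ss; case: nS; exists s.
have ny0 : 0 < `|y| by rewrite normr_gt0.
have [x [x1 yx]] : exists x, `|x| <= 1 /\ `|y| / 2 < `|subspace_val y x|.
  apply: contrapT => /forallNP nx.
  suff : `|y| <= `|y| / 2 by lra.
  apply: dual_norm_le => x x1; rewrite leNgt; apply/negP => yx.
  by apply: (nx x).
have [n0 yn0] := fspaceP y.
(* The successor keeps [n] positive, so that the correcting jumps occur at a true time, which [y]
   does not see. *)
pose n := n0.+1; have yn := fproj_widen (leqnSn n0) yn0.
pose z := proj (lo R (before n)) x.
have zn : `|z| <= 1 by rewrite (le_trans (proj_norm _ _)).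
have zz : proj (lo R (before n)) z = z.
  by rewrite /z (proj_comp (b := lo R (before n)))// => t _; rewrite andbb.
pose w := z - \sum_(i < n.*2) z (ltot R i) *: jump R n i.
have wn : `|w| <= 2.
  rewrite (le_trans (ler_normB _ _))// (_ : 2 = 1 + 1)// lerD//.
  apply: (@jump_sum_norm R n _ (fun i => z (ltot R i)))=> // k _.
  by rewrite (le_trans (tspace_norm _ _)).
have yjump i : subspace_val y (jump R n i) = 0.
  rewrite -yn fprojE /jump dvec_lo ifF ?linear0//.
  by case: ifP => //; rewrite ltnn andbF.
have yw : eval_at w y = subspace_val y x.
  rewrite eval_atE /w linearB linear_sum big1 ?subr0; last first.
    by move=> i _; rewrite [LHS]dualZ yjump mulr0.
  by rewrite /z -[RHS](congr1 (fun f : dual_space X => f x) yn).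
have wM : eval_at w \in msubspace.
  apply/asboolP => k.
  have w0 : w (ltest R k) = 0.
    rewrite /w tfunB tfun_sum; have [kn|kn] := ltnP k n; last first.
      rewrite (lo_ltest_ge zz kn) big1 ?subr0// => i _.
      rewrite tfunZ /jump dvecE /=.
      rewrite (_ : (i./2 == k) = false) ?andbF ?mulr0//.
      by rewrite ltn_eqF// (leq_trans _ kn)// ltn_half_double.
    have k2 : (k.*2 < n.*2)%N by rewrite ltn_double.
    rewrite (bigD1 (Ordinal k2))//= big1 ?addr0.
      rewrite -[X in _ - X]/(z (ltot R k.*2) * jump R n k.*2 (ltest R k)).
      by rewrite /jump /ltot odd_double doubleK dvecE /= kn eqxx mulr1 subrr.
    move=> i; rewrite -val_eqE /= => ik.
    rewrite -[LHS]/(z (ltot R i) * jump R n i (ltest R k)) /jump dvecE /=.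
    case: (boolP (odd i)) => oi /=; first by rewrite mulr0.
    rewrite (_ : (i./2 == k) = false) ?andbF ?mulr0//.
    by apply: contraNF ik => /eqP <-; rewrite even_halfK.
  have zm m : (n < m)%N -> proj (lo R (before m)) z = z.
    move=> nm; rewrite -{1}zz (proj_comp (b := lo R (before n))) ?zz// => t _ /=.
    by case: (ltnP t n) => tn; rewrite ?andbF// (ltn_trans tn nm).
  have wlo m : (n < m)%N -> proj (lo R (before m)) w (ltest R k) = w (ltest R k).
    move=> nm; rewrite [in RHS]/w tfunB tfun_sum {1}/w linearB linear_sum tfunB tfun_sum.
    congr (_ - _).
      exact: (congr1 (fun u : X => u (ltest R k)) (zm m nm)).
    apply: eq_bigr => i _; rewrite linearZ /= /jump.
    case: (boolP (odd i)) => _ /=; first by rewrite /mask_fun.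
    by rewrite /mask_fun /= nm.
  have : (fun m : nat => 0 : R) @ \oo --> (0 : R) by exact: cvg_cst.
  apply: cvg_trans; apply: near_eq_cvg; exists n.+1 => // m nm.
  have E : eval_at w (ysum m k) = 0 by rewrite eval_ysum wlo// w0.
  exact: esym E.
have Fw0 : 0 < `|eval_at w|.
  rewrite normr_gt0; apply: contraTneq yx => w0.
  by rewrite -yw w0 normr0 -leNgt divr_ge0.
apply: (@le_trans _ _ (`|(`|eval_at w|^-1 *: eval_at w) y|)).
  rewrite dual_scale normrM normfV normr_id ler_pdivlMl// yw.
  have := le_trans (eval_at_norm w) wn.
  have := normr_ge0 y; nra.
apply: sup_upper_bound.
  by split => //; exists `|(`|eval_at w|^-1 *: eval_at w) y|; eexists; last reflexivity;
    split; [apply: rpredZ|rewrite /= normfZV// -normr_gt0].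
by eexists; last reflexivity; split; [apply: rpredZ|rewrite /= normfZV// -normr_gt0].
Qed.

(** The functionals [G k] come from the earliest admissible jump of coordinate [k], and are
    biorthogonal to the limits; [n + 1] of them would be dependent modulo the subspace, and some
    limit of the combination is not 0. *)
Lemma infinite_codimension_msubspace : infinite_codimension msubspace.
Proof.
move=> [n [e eP]]; pose G k := eval_at (dvec R k.+1 k).
have GE k m j : (k.+1 < m)%N -> G k (ysum m j) = (k == j)%:R.
  by move=> km; rewrite /G eval_ysum dvec_lo km /= ltnSn.
have [a aP] := choice (fun k => eP (G k)).
have [v v0 vA] := @nontrivial_left_kernel R n (\matrix_(k, i) a k i).
have [j vj] : exists j, v 0 j != 0.
  apply: contrapT => /forallNP vj; case/eqP: v0; apply/rowP => j; rewrite mxE.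
  by have /negP := vj j; rewrite negbK => /eqP.
pose F := \sum_(k < n.+1) v 0 k *: (G k - \sum_(i < n) a k i *: e i).
have FM : F \in msubspace by apply: rpred_sum => k _; apply: rpredZ; exact: aP.
have FE : F = \sum_(k < n.+1) v 0 k *: G k.
  rewrite /F; under eq_bigr do rewrite scalerBr.
  rewrite sumrB (_ : \sum_(k < n.+1) v 0 k *: (\sum_(i < n) _) = 0) ?subr0//.
  under eq_bigr do rewrite scaler_sumr.
  rewrite exchange_big big1// => i _ /=.
  have := congr1 (fun M : 'rV_n => M 0 i) vA; rewrite !mxE => vi.
  transitivity ((\sum_(k < n.+1) v 0 k * a k i) *: e i).
    by rewrite scaler_suml; apply: eq_bigr => k _; rewrite scalerA.
  rewrite (_ : \sum_(k < n.+1) _ = 0) ?scale0r// -[RHS]vi.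
  by apply: eq_bigr => k _; rewrite mxE.
have /asboolP /(_ j) := FM => F0.
have Fj : F (ysum m j) @[m --> \oo] --> v 0 j.
  have : (fun m : nat => v 0 j) @ \oo --> v 0 j by exact: cvg_cst.
  apply: cvg_trans; apply: near_eq_cvg; exists n.+2 => // m nm.
  suff E : F (ysum m j) = v 0 j by exact: esym E.
  rewrite FE dual_sum (bigD1 j)//= big1 ?addr0.
    by rewrite -[LHS]/(v 0 j * G j (ysum m j)) GE ?eqxx ?mulr1// (leq_trans _ nm)// !ltnS -ltnS.
  move=> k kj; rewrite -[LHS]/(v 0 k * G k (ysum m j)) GE.
    by rewrite (_ : (k == j :> nat) = false) ?mulr0//; exact/negbTE.
  by rewrite (leq_trans _ nm)// !ltnS -ltnS.
by case/eqP: vj; apply: (cvg_unique _ Fj F0).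
Qed.

Lemma separable_tspace : separable X.
Proof.
apply: (@separable_of_combinations R X (dvec R)) => x d d0.
by have [n [a xa]] := fcomb_dense x d0; exists n, a.
Qed.

Lemma separable_fspace : separable Y.
Proof.
apply: (@separable_of_combinations R Y (yunit R)) => y d d0.
have [n yn] := fspaceP y; exists n, (fun t k => subspace_val y (dvec R t k)).
have -> : \sum_(t < n) \sum_(k < n) subspace_val y (dvec R t k) *: yunit R t k = y.
  by rewrite pair_big -ylo_sum; apply: val_inj.
by rewrite subrr normr0 ltW.
Qed.

End NormingSubspace.

Theorem theorem1 (R : realType) :
  exists (X : completeNormedModType R) (Y : submodClosed (dual_space X)),
    [/\ separable X,
        separable (subspace_type Y),
        (exists M : submodClosed (dual_space (subspace_type Y)),
           [/\ closed [set` M], norming [set` M] & infinite_codimension M])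
      & ~ exists T : {linear subspace_type Y -> dual_space X},
            isomorphic_embedding T /\ total_set (range T)].
Proof.
exists (tspace R), (@fspace R); split.
- exact: separable_tspace.
- exact: separable_fspace.
- exists (@msubspace R); split.
  + exact: closed_msubspace.
  + exact: norming_msubspace.
  + exact: infinite_codimension_msubspace.
- move=> [T [/isomorphic_embedding_bounds[[C TC] [B B0 TB]] Ttot]].
  have [x x0 Tx] := embedding_not_total TC B0 TB.
  by have [_ [y _ <-]] := Ttot x x0; rewrite Tx eqxx.
Qed.
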